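(* Let $n\ge3$ be odd, let $\mathbb{F}$ be a field containing a primitive $n$th root of unity $\omega$, and let $H=u_q(\mathfrak{sl}_2)$ be the Hopf algebra generated by $a,x,y$ presented in the context. Suppose $H$ acts on a matrix algebra $A$ over $\mathbb{F}$. The action is inner, via a convolution invertible map $u:H\to A$, so that for all $b\in A$ $$a*b=u(a)bu(a)^{-1},\quad x*b=u(x)bu(a)^{-1}-bu(x)u(a)^{-1},\quad y*b=u(y)b-u(a)^{-1}bu(a)u(y),$$ and the elements $u(a),u(x),u(y)\in A$ in these formulas can be chosen so that $$u(a)^n=\theta 1,\quad u(a)u(x)=\omega^2u(x)u(a),\quad u(a)u(y)=\omega^{-2}u(y)u(a),$$ $$u(x)^n=\mu1,\quad u(y)^n=\nu1,\quad u(x)u(y)-u(y)u(x)=u(a)-\tau u(a)^{-1},$$ for some $\theta,\tau,\mu,\nu\in\mathbb{F}$ with $\theta\neq0$.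
   Context: The Hopf algebra $H=u_q(\mathfrak{sl}_2)$ is generated by $a,x,y$ with relations $a^n=1$, $x^n=y^n=0$, $ax=\omega^2xa$, $ay=\omega^{-2}ya$, $xy-yx=a-a^{-1}$, and coproduct $\Delta(a)=a\otimes a$, $\Delta(x)=x\otimes a+1\otimes x$, $\Delta(y)=y\otimes1+a^{-1}\otimes y$. An action of $H$ on $A$ is an $H$-module algebra structure $(h,b)\mapsto h*b$; it is inner via a convolution invertible linear map $u:H\to A$ with $u(1)=1_A$ if $h*b=\sum u(h_{(1)})bu^{-1}(h_{(2)})$, $u^{-1}$ being the convolution inverse. *)

(* Defs.v *)
From HB Require Import structures.
From mathcomp Require Import all_boot all_order all_algebra.
From mathcomp Require Import boolp.
From mathcomp Require Import monalg.
From mathcomp Require Import ring.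

Set Implicit Arguments.
Unset Strict Implicit.
Unset Printing Implicit Defensive.

Import GRing.Theory.
Local Open Scope ring_scope.
Local Open Scope quotient_scope.

Notation is_bilinear f := (bilinear_for *:%R *:%R f).

Section Ideal.
Variable T : nzRingType.

Definition two_sided_ideal (I : T -> Prop) : Prop :=
  [/\ I 0,
      forall p q, I p -> I q -> I (p + q),
      forall r p, I p -> I (r * p)
    & forall r p, I p -> I (p * r)].

Definition ideal_gen (S : seq T) (p : T) : Prop :=
  forall I : T -> Prop,
    two_sided_ideal I -> (forall s, s \in S -> I s) -> I p.

Lemma ideal_gen_ideal S : two_sided_ideal (ideal_gen S).
Proof.
split=> [I [I0 _ _ _] _ //|p q Ip Iq I HI HS|r p Ip I HI HS|r p Ip I HI HS];
  case: (HI) => I0 ID IMl IMr.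
- by apply: ID; [apply: Ip | apply: Iq].
- by apply: IMl; apply: Ip.
- by apply: IMr; apply: Ip.
Qed.

Lemma mem_ideal_gen (S : seq T) s : s \in S -> ideal_gen S s.
Proof. by move=> sS I _; apply. Qed.

Lemma ideal_gen0 S : ideal_gen S 0.
Proof. by case: (ideal_gen_ideal S). Qed.

Lemma ideal_genD S p q : ideal_gen S p -> ideal_gen S q -> ideal_gen S (p + q).
Proof. by case: (ideal_gen_ideal S) => _ + _ _; apply. Qed.

Lemma ideal_genMl S r p : ideal_gen S p -> ideal_gen S (r * p).
Proof. by case: (ideal_gen_ideal S) => _ _ + _; apply. Qed.

Lemma ideal_genMr S r p : ideal_gen S p -> ideal_gen S (p * r).
Proof. by case: (ideal_gen_ideal S) => _ _ _; apply. Qed.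

Lemma ideal_genN S p : ideal_gen S p -> ideal_gen S (- p).
Proof. by rewrite -mulN1r; apply: ideal_genMl. Qed.

Lemma ideal_gen_mulB S r p s q :
  ideal_gen S (r - p) -> ideal_gen S (s - q) -> ideal_gen S (r * s - p * q).
Proof.
move=> Srp Ssq; rewrite -(subrKA (p * s)) -mulrBl -mulrBr.
by apply: ideal_genD; [apply: ideal_genMr|apply: ideal_genMl].
Qed.

Definition ideal_equiv (S : seq T) : rel T := fun p q => `[< ideal_gen S (p - q) >].

Lemma ideal_equiv_refl S : reflexive (ideal_equiv S).
Proof. by move=> p; apply/asboolP; rewrite subrr; apply: ideal_gen0. Qed.

Lemma ideal_equiv_sym S : symmetric (ideal_equiv S).
Proof.
by move=> p q; apply/asboolP/asboolP => /ideal_genN; rewrite opprB.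
Qed.

Lemma ideal_equiv_trans S : transitive (ideal_equiv S).
Proof.
move=> q p r /asboolP Hpq /asboolP Hqr; apply/asboolP.
by rewrite -(subrKA q); apply: ideal_genD.
Qed.

Canonical ideal_equivRel S :=
  EquivRel (ideal_equiv S) (ideal_equiv_refl S) (ideal_equiv_sym S)
    (ideal_equiv_trans (S := S)).

End Ideal.

Section FreeAlgebra.
Variables (F : fieldType) (I : choiceType).

Lemma malgC_comm (k : F) (p : {malg F[{fmonom I}]}) : p * k%:MP = k%:MP * p.
Proof.
rewrite [LHS]malgM_def [RHS]malgM_def fgmulgU fgmulUg.
by apply: eq_bigr => m _; rewrite mulm1 mul1m mulrC.
Qed.

Lemma malg_scalerAr (k : F) (p q : {malg F[{fmonom I}]}) :
  k *: (p * q) = p * (k *: q).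
Proof. by rewrite -(mul_malgC k q) mulrA malgC_comm -mulrA mul_malgC. Qed.

Lemma fmu_ind (P : {malg F[{fmonom I}]} -> Prop) :
  P 1 -> (forall k p, P p -> P (k *: p)) ->
  (forall p q, P p -> P q -> P (p + q)) ->
  (forall i p, P p -> P (<< fmu i >> * p)) ->
  forall p, P p.
Proof.
move=> P1 PZ PD PM p; rewrite [p]monalgE.
have P0 : P 0 by rewrite -(scale0r 1); apply: PZ.
have Pm m : P << m >>.
  case: m; elim=> [|i s IHs]; first by rewrite -fmoneE.
  suff -> : << FMonom (i :: s) >> = << fmu i >> * << FMonom s >>
    :> {malg F[{fmonom I}]} by exact: PM.
  rewrite [RHS]malgM_def fgmulUU mulr1; congr (<< 1 *g _ >>).
  by rewrite fmuE; symmetry; apply: fmmulE.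
apply: big_ind => // m _.
have -> : << p@_m *g m >> = p@_m *: << m >>.
  by apply/malgP => m'; rewrite mcoeffZ !mcoeffU mulrnAr mulr1.
exact: PZ.
Qed.

Variables (B : algType F) (v : I -> B).

Definition word_eval (m : {fmonom I}) : B := \prod_(i <- (m : seq I)) v i.

Lemma word_eval_mmorphism : mmorphism word_eval.
Proof.
split=> [m m'|]; rewrite /word_eval; first by rewrite fmM big_cat.
by rewrite fm1 big_nil.
Qed.
HB.instance Definition _ :=
  monalg.isMultiplicative.Build {fmonom I} B word_eval word_eval_mmorphism.

Definition free_eval : {malg F[{fmonom I}]} -> B := mmap (in_alg B) word_eval.

Lemma free_evalM : {morph free_eval : p q / p * q}.
Proof.
apply: (commr_mmap_is_multiplicative (f := in_alg B) (h := word_eval) _).1.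
by move=> g m m'; rewrite /GRing.comm mulr_algl mulr_algr.
Qed.

Lemma free_eval1 : free_eval 1 = 1.
Proof. by rewrite /free_eval mmap1. Qed.

Lemma free_evalZ k p : free_eval (k *: p) = k *: free_eval p.
Proof. by rewrite /free_eval mmapZ mulr_algl. Qed.

Lemma free_evalD : {morph free_eval : p q / p + q}.
Proof. exact: mmapD. Qed.

Lemma free_evalU i : free_eval << fmu i >> = v i.
Proof. by rewrite /free_eval mmapU /= scale1r mul1r /word_eval fmU big_seq1. Qed.

HB.instance Definition _ := GRing.isZmodMorphism.Build _ _ free_eval
  (@mmapB _ _ _ (in_alg B) word_eval).
HB.instance Definition _ := GRing.isMonoidMorphism.Build _ _ free_eval
  (free_eval1, free_evalM).
HB.instance Definition _ := GRing.isScalable.Build _ _ _ _ free_eval free_evalZ.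

End FreeAlgebra.

(* Since a^n = 1, the element a^{-1} of the presentation is a^{n-1}. *)
Definition uq_relators (F : fieldType) (n : nat) (w : F) (B : lalgType F)
    (a x y : B) : seq B :=
  [:: a ^+ n - 1;
      x ^+ n;
      y ^+ n;
      a * x - w ^+ 2 *: (x * a);
      a * y - w ^- 2 *: (y * a);
      (x * y - y * x) - (a - a ^+ n.-1)].

Lemma map_uq_relators (F : fieldType) n (w : F) (A B : lalgType F)
    (f : {lrmorphism A -> B}) (a x y : A) :
  map f (uq_relators n w a x y) = uq_relators n w (f a) (f x) (f y).
Proof.
rewrite /uq_relators /=; congr [:: _; _; _; _; _; _].
- by rewrite rmorphB rmorphXn rmorph1.
- by rewrite rmorphXn.
- by rewrite rmorphXn.
- by rewrite linearB /= linearZZ /= !rmorphM.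
- by rewrite linearB /= linearZZ /= !rmorphM.
- by rewrite !rmorphB /= !rmorphM rmorphXn.
Qed.

Section Uqsl2.
Variables (F : fieldType) (n : nat) (w : F).

Local Notation free := {malg F[{fmonom 'I_3}]}.

Definition uq_letter (i : 'I_3) : free := << fmu i >>.
Definition uq_free_relators : seq free :=
  uq_relators n w (uq_letter 0) (uq_letter 1) (uq_letter 2).

(* u_q(sl_2): the free algebra on three letters modulo the two-sided ideal
   generated by the defining relators.  The arguments odd_n and prim_w make the
   counit and the comultiplication below well defined. *)
Definition uqsl2 (odd_n : odd n) (prim_w : n.-primitive_root w) : Type :=
  {eq_quot (ideal_equiv uq_free_relators)}.

Variables (odd_n : odd n) (prim_w : n.-primitive_root w).
Local Notation H := (uqsl2 odd_n prim_w).

HB.instance Definition _ := Choice.on H.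
HB.instance Definition _ := EqQuotient.on H.

Definition uq_pi (p : free) : H := \pi_H p.

Lemma uq_piP p q : (uq_pi p = uq_pi q) <-> ideal_gen uq_free_relators (p - q).
Proof.
split=> [/eqmodP /asboolP //|Hpq]; by apply/eqmodP/asboolP.
Qed.

Lemma uq_reprK (h : H) : uq_pi (repr h) = h.
Proof. exact: reprK. Qed.

Let zero : H := uq_pi 0.
Let one : H := uq_pi 1.
Let opp (g : H) : H := uq_pi (- repr g).
Let add (g h : H) : H := uq_pi (repr g + repr h).
Let mul (g h : H) : H := uq_pi (repr g * repr h).
Let scale (k : F) (h : H) : H := uq_pi (k *: repr h).

Let repr_pi p : ideal_gen uq_free_relators (repr (uq_pi p) - p).
Proof. by apply/uq_piP; rewrite uq_reprK. Qed.

Let piN p : opp (uq_pi p) = uq_pi (- p).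
Proof.
apply/uq_piP; rewrite opprK addrC -opprB.
by apply: ideal_genN; apply: repr_pi.
Qed.

Let piD p q : add (uq_pi p) (uq_pi q) = uq_pi (p + q).
Proof.
by apply/uq_piP; rewrite opprD addrACA; apply: ideal_genD; apply: repr_pi.
Qed.

Let piM p q : mul (uq_pi p) (uq_pi q) = uq_pi (p * q).
Proof.
by apply/uq_piP; apply: ideal_gen_mulB; apply: repr_pi.
Qed.

Let piZ k p : scale k (uq_pi p) = uq_pi (k *: p).
Proof.
apply/uq_piP; rewrite -scalerBr -mul_malgC.
by apply: ideal_genMl; apply: repr_pi.
Qed.

Let addA : associative add.
Proof.
move=> f g h; rewrite -(uq_reprK f) -(uq_reprK g) -(uq_reprK h).
by rewrite !piD addrA.
Qed.
Let addC : commutative add.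
Proof. by move=> f g; rewrite /add addrC. Qed.
Let add0 : left_id zero add.
Proof. by move=> f; rewrite -(uq_reprK f) piD add0r. Qed.
Let addN : left_inverse zero opp add.
Proof. by move=> f; rewrite -(uq_reprK f) piN piD addNr. Qed.

HB.instance Definition _ := GRing.isZmodule.Build H addA addC add0 addN.

Let mulA : associative mul.
Proof.
move=> f g h; rewrite -(uq_reprK f) -(uq_reprK g) -(uq_reprK h).
by rewrite !piM mulrA.
Qed.
Let mul1 : left_id one mul.
Proof. by move=> f; rewrite -(uq_reprK f) piM mul1r. Qed.
Let mul1' : right_id one mul.
Proof. by move=> f; rewrite -(uq_reprK f) piM mulr1. Qed.
Let mulDl : left_distributive mul add.
Proof.
move=> f g h; rewrite -(uq_reprK f) -(uq_reprK g) -(uq_reprK h).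
by rewrite !(piM, piD) mulrDl.
Qed.
Let mulDr : right_distributive mul add.
Proof.
move=> f g h; rewrite -(uq_reprK f) -(uq_reprK g) -(uq_reprK h).
by rewrite !(piM, piD) mulrDr.
Qed.

Lemma free_eval_ideal (B : algType F) (v : 'I_3 -> B) :
  {in uq_relators n w (v 0) (v 1) (v 2), forall r, r = 0} ->
  forall p, ideal_gen uq_free_relators p -> free_eval v p = 0.
Proof.
move=> Hv p /(_ (fun q => free_eval v q = 0)); apply; first split=> [|q r q0 r0|r q q0|r q q0].
- exact: rmorph0.
- by rewrite rmorphD /= q0 r0 addr0.
- by rewrite rmorphM /= q0 mulr0.
- by rewrite rmorphM /= q0 mul0r.
move=> s sI; apply: Hv.
suff -> : uq_relators n w (v 0) (v 1) (v 2) = map (free_eval v) uq_free_relators.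
  exact: map_f.
rewrite map_uq_relators.
by congr uq_relators; symmetry; apply: free_evalU.
Qed.

Let uq_n_gt0 : (0 < n)%N. Proof. by case: (n) odd_n. Qed.

Definition uq_counit_letter (i : 'I_3) : F^o := if i == 0 then 1 else 0.

Lemma uq_counit_rel :
  {in uq_relators n w (uq_counit_letter 0) (uq_counit_letter 1)
        (uq_counit_letter 2), forall r, r = 0}.
Proof.
have n0 : 0 ^+ n = 0 :> F^o by rewrite expr0n eqn0Ngt uq_n_gt0.
move=> r; rewrite /uq_relators /uq_counit_letter /= !inE !expr1n n0.
by rewrite !(mulr0, mul0r, scaler0, subrr) !orbb => /eqP.
Qed.

Let one_neq0 : one != zero.
Proof.
apply/eqP => /uq_piP /(free_eval_ideal uq_counit_rel) /eqP.
by rewrite subr0 rmorph1 oner_eq0.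
Qed.

HB.instance Definition _ :=
  GRing.Zmodule_isNzRing.Build H mulA mul1 mul1' mulDl mulDr one_neq0.

Let scaleA k l h : scale k (scale l h) = scale (k * l) h.
Proof. by rewrite -(uq_reprK h) !piZ scalerA. Qed.
Let scale1 : left_id 1 scale.
Proof. by move=> h; rewrite -(uq_reprK h) piZ scale1r. Qed.
Let scaleDr : right_distributive scale add.
Proof.
move=> k g h; rewrite -(uq_reprK g) -(uq_reprK h).
by rewrite !(piD, piZ) scalerDr.
Qed.
Let scaleDl h k l : scale (k + l) h = add (scale k h) (scale l h).
Proof. by rewrite -(uq_reprK h) !(piD, piZ) scalerDl. Qed.

HB.instance Definition _ :=
  GRing.Zmodule_isLmodule.Build F H scaleA scale1 scaleDr scaleDl.

Let scaleAl k g h : scale k (mul g h) = mul (scale k g) h.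
Proof. by rewrite -(uq_reprK g) -(uq_reprK h) !(piM, piZ) scalerAl. Qed.

HB.instance Definition _ := GRing.Lmodule_isLalgebra.Build F H scaleAl.

Let scaleAr k g h : scale k (mul g h) = mul g (scale k h).
Proof. by rewrite -(uq_reprK g) -(uq_reprK h) !(piM, piZ) malg_scalerAr. Qed.

HB.instance Definition _ := GRing.Lalgebra_isAlgebra.Build F H scaleAr.

Lemma uq_pi1 : uq_pi 1 = 1. Proof. by []. Qed.
Lemma uq_piD p q : uq_pi (p + q) = uq_pi p + uq_pi q.
Proof. exact: esym (piD p q). Qed.
Lemma uq_piN p : uq_pi (- p) = - uq_pi p.
Proof. exact: esym (piN p). Qed.
Lemma uq_piM p q : uq_pi (p * q) = uq_pi p * uq_pi q.
Proof. exact: esym (piM p q). Qed.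
Lemma uq_piZ k p : uq_pi (k *: p) = k *: uq_pi p.
Proof. exact: esym (piZ k p). Qed.

HB.instance Definition _ := GRing.isZmodMorphism.Build _ _ uq_pi
  (fun p q => etrans (uq_piD p (- q)) (congr1 (+%R (uq_pi p)) (uq_piN q))).
HB.instance Definition _ := GRing.isMonoidMorphism.Build _ _ uq_pi (uq_pi1, uq_piM).
HB.instance Definition _ := GRing.isScalable.Build _ _ _ _ uq_pi uq_piZ.

Definition uq_a : H := uq_pi (uq_letter 0).
Definition uq_x : H := uq_pi (uq_letter 1).
Definition uq_y : H := uq_pi (uq_letter 2).

Lemma uq_relE r : r \in uq_relators n w uq_a uq_x uq_y -> r = 0.
Proof.
rewrite -map_uq_relators => /mapP[s sI ->]; rewrite -(rmorph0 uq_pi).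
by apply/uq_piP; rewrite subr0; apply: mem_ideal_gen.
Qed.

Lemma uq_ind (P : H -> Prop) :
  P 1 -> (forall k h, P h -> P (k *: h)) ->
  (forall g h, P g -> P h -> P (g + h)) ->
  (forall h, P h -> P (uq_a * h)) -> (forall h, P h -> P (uq_x * h)) ->
  (forall h, P h -> P (uq_y * h)) ->
  forall h, P h.
Proof.
move=> P1 PZ PD Pa Px Py h; rewrite -(uq_reprK h).
apply: (@fmu_ind F 'I_3 (fun p => P (uq_pi p))) => [|k p Hp|p q Hp Hq|i p Hp].
- exact: P1.
- by rewrite uq_piZ; apply: PZ.
- by rewrite uq_piD; apply: PD.
rewrite uq_piM; case: i => -[|[|[|//]]] i3.
- by rewrite (_ : Ordinal i3 = 0); [apply: Pa|apply: val_inj].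
- by rewrite (_ : Ordinal i3 = 1); [apply: Px|apply: val_inj].
- by rewrite (_ : Ordinal i3 = 2); [apply: Py|apply: val_inj].
Qed.

Section Lift.
Variables (B : algType F) (v : 'I_3 -> B).
Hypothesis Hv : {in uq_relators n w (v 0) (v 1) (v 2), forall r, r = 0}.

Definition uq_lift & {in uq_relators n w (v 0) (v 1) (v 2), forall r, r = 0} :=
  fun h : H => free_eval v (repr h).

Let lift := uq_lift Hv.

Lemma uq_liftE p : lift (uq_pi p) = free_eval v p.
Proof.
apply/eqP; rewrite -subr_eq0 -rmorphB; apply/eqP.
by apply: (free_eval_ideal Hv); apply: repr_pi.
Qed.

Lemma uq_lift_zmod : zmod_morphism lift.
Proof.
move=> g h; rewrite -(uq_reprK g) -(uq_reprK h) -[_ - _](rmorphB uq_pi).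
by rewrite !uq_liftE rmorphB.
Qed.

Lemma uq_lift_monoid : monoid_morphism lift.
Proof.
split=> [|g h]; first by rewrite -uq_pi1 uq_liftE rmorph1.
by rewrite -(uq_reprK g) -(uq_reprK h) -uq_piM !uq_liftE rmorphM.
Qed.

Lemma uq_lift_scale : scalable lift.
Proof. by move=> k h; rewrite -(uq_reprK h) -uq_piZ !uq_liftE linearZ. Qed.

Lemma uq_lift_a : lift uq_a = v 0.
Proof. by rewrite uq_liftE free_evalU. Qed.
Lemma uq_lift_x : lift uq_x = v 1.
Proof. by rewrite uq_liftE free_evalU. Qed.
Lemma uq_lift_y : lift uq_y = v 2.
Proof. by rewrite uq_liftE free_evalU. Qed.

End Lift.

HB.instance Definition _ B v Hv :=
  GRing.isZmodMorphism.Build _ _ (@uq_lift B v Hv) (uq_lift_zmod Hv).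
HB.instance Definition _ B v Hv :=
  GRing.isMonoidMorphism.Build _ _ (@uq_lift B v Hv) (uq_lift_monoid Hv).
HB.instance Definition _ B v Hv :=
  GRing.isScalable.Build _ _ _ _ (@uq_lift B v Hv) (uq_lift_scale Hv).

Definition uq_counit : H -> F^o := uq_lift uq_counit_rel.

HB.instance Definition _ := GRing.LRMorphism.on uq_counit.

End Uqsl2.

(* The tensor product of two algebras: formal sums of pairs, two of them being
   identified when every bilinear map takes the same value on both. *)
Section Tensor.
Variables (R : comNzRingType) (A B : algType R).

Definition formal_sum (W : nmodType) (f : A -> B -> W) (s : seq (A * B)) : W :=
  \sum_(p <- s) f p.1 p.2.

Definition tensor_equiv : rel (seq (A * B)) := fun s t =>
  `[< forall (W : lmodType R) (f : A -> B -> W),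
        is_bilinear f -> formal_sum f s = formal_sum f t >].

Lemma tensor_equiv_refl : reflexive tensor_equiv.
Proof. by move=> s; apply/asboolP. Qed.

Lemma tensor_equiv_sym : symmetric tensor_equiv.
Proof.
by move=> s t; apply/asboolP/asboolP => st W f Hf; rewrite (st W f Hf).
Qed.

Lemma tensor_equiv_trans : transitive tensor_equiv.
Proof.
move=> t s r /asboolP st /asboolP tr; apply/asboolP => W f Hf.
by rewrite (st W f Hf) (tr W f Hf).
Qed.

Canonical tensor_equivRel :=
  EquivRel tensor_equiv tensor_equiv_refl tensor_equiv_sym tensor_equiv_trans.

Definition tensor : Type := {eq_quot tensor_equiv}.

HB.instance Definition _ := Choice.on tensor.
HB.instance Definition _ := EqQuotient.on tensor.

Definition tensor_sum (s : seq (A * B)) : tensor := \pi_tensor s.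
Definition tens (a : A) (b : B) : tensor := tensor_sum [:: (a, b)].

(* The value at t of the linear map out of the tensor product induced by f;
   meaningful when f is bilinear. *)
Definition tensor_lift (W : nmodType) (f : A -> B -> W) (t : tensor) : W :=
  formal_sum f (repr t).

Lemma tensor_liftE (W : lmodType R) (f : A -> B -> W) s :
  is_bilinear f -> tensor_lift f (tensor_sum s) = formal_sum f s.
Proof.
move=> Hf; suff /asboolP : tensor_equiv (repr (tensor_sum s)) s by apply.
by apply/eqmodP; rewrite reprK.
Qed.

Lemma tensorP (t u : tensor) :
  (forall (W : lmodType R) (f : A -> B -> W), is_bilinear f ->
     tensor_lift f t = tensor_lift f u) -> t = u.
Proof.
by move=> tu; rewrite -(reprK t) -(reprK u); apply/eqmodP/asboolP.
Qed.

Section Bilinear.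
Variables (W : lmodType R) (f : A -> B -> W).
Hypothesis f_bil : is_bilinear f.

Lemma bilinear0l b : f 0 b = 0.
Proof. by have /= := f_bil.1 b (-1) 0 0; rewrite scaler0 addr0 scaleN1r addNr. Qed.
Lemma bilinear0r a : f a 0 = 0.
Proof. by have /= := f_bil.2 a (-1) 0 0; rewrite scaler0 addr0 scaleN1r addNr. Qed.
Lemma bilinearDl a a' b : f (a + a') b = f a b + f a' b.
Proof. by have /= := f_bil.1 b 1 a a'; rewrite !scale1r. Qed.
Lemma bilinearDr a b b' : f a (b + b') = f a b + f a b'.
Proof. by have /= := f_bil.2 a 1 b b'; rewrite !scale1r. Qed.
Lemma bilinearZl k a b : f (k *: a) b = k *: f a b.
Proof. by have /= := f_bil.1 b k a 0; rewrite bilinear0l !addr0. Qed.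
Lemma bilinearZr k a b : f a (k *: b) = k *: f a b.
Proof. by have /= := f_bil.2 a k b 0; rewrite bilinear0r !addr0. Qed.

End Bilinear.

Let zero : tensor := tensor_sum [::].
Let add (t u : tensor) : tensor := tensor_sum (repr t ++ repr u).
Let scale (k : R) (t : tensor) : tensor :=
  tensor_sum [seq (k *: p.1, p.2) | p <- repr t].
Let opp (t : tensor) : tensor := scale (-1) t.
Let one : tensor := tens 1 1.
Let mul (t u : tensor) : tensor :=
  tensor_sum [seq (p.1 * q.1, p.2 * q.2) | p <- repr t, q <- repr u].

Let lift0 (W : lmodType R) (f : A -> B -> W) :
  is_bilinear f -> tensor_lift f zero = 0.
Proof. by move=> Hf; rewrite tensor_liftE // /formal_sum big_nil. Qed.

Let liftD (W : lmodType R) (f : A -> B -> W) t u : is_bilinear f ->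
  tensor_lift f (add t u) = tensor_lift f t + tensor_lift f u.
Proof. by move=> Hf; rewrite tensor_liftE // /formal_sum big_cat. Qed.

Let liftZ (W : lmodType R) (f : A -> B -> W) k t : is_bilinear f ->
  tensor_lift f (scale k t) = k *: tensor_lift f t.
Proof.
move=> Hf; rewrite tensor_liftE // /formal_sum big_map scaler_sumr.
by apply: eq_bigr => p _; rewrite /= bilinearZl.
Qed.

Let lift1 (W : lmodType R) (f : A -> B -> W) :
  is_bilinear f -> tensor_lift f one = f 1 1.
Proof. by move=> Hf; rewrite tensor_liftE // /formal_sum big_seq1. Qed.

Let liftM (W : lmodType R) (f : A -> B -> W) t u : is_bilinear f ->
  tensor_lift f (mul t u) = tensor_lift (fun a b =>
    tensor_lift (fun a' b' => f (a * a') (b * b')) u) t.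
Proof.
by move=> Hf; rewrite tensor_liftE // /formal_sum big_allpairs_dep.
Qed.

Let bil_mull (W : lmodType R) (f : A -> B -> W) a b : is_bilinear f ->
  is_bilinear (fun a' b' => f (a * a') (b * b')).
Proof.
move=> Hf; split=> [b'|a'] k c d /=; rewrite mulrDr -scalerAr.
  exact: Hf.1.
exact: Hf.2.
Qed.

Let bil_mulr (W : lmodType R) (f : A -> B -> W) u : is_bilinear f ->
  is_bilinear (fun a b => tensor_lift (fun a' b' => f (a * a') (b * b')) u).
Proof.
move=> Hf; split=> [b|a] k c d /=; rewrite /tensor_lift /formal_sum;
  rewrite scaler_sumr -big_split /=; apply: eq_bigr => p _;
  rewrite mulrDl -scalerAl.
  exact: Hf.1.
exact: Hf.2.
Qed.

Let addA : associative add.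
Proof. by move=> t u v; apply: tensorP => W f Hf; rewrite !liftD ?addrA. Qed.
Let addC : commutative add.
Proof. by move=> t u; apply: tensorP => W f Hf; rewrite !liftD 1?addrC. Qed.
Let add0 : left_id zero add.
Proof. by move=> t; apply: tensorP => W f Hf; rewrite liftD ?lift0 ?add0r. Qed.
Let addN : left_inverse zero opp add.
Proof.
move=> t; apply: tensorP => W f Hf.
by rewrite liftD ?liftZ ?lift0 // scaleN1r addNr.
Qed.

HB.instance Definition _ := GRing.isZmodule.Build tensor addA addC add0 addN.

Let scaleA k l t : scale k (scale l t) = scale (k * l) t.
Proof. by apply: tensorP => W f Hf; rewrite !liftZ // scalerA. Qed.
Let scale1 : left_id 1 scale.
Proof. by move=> t; apply: tensorP => W f Hf; rewrite !liftZ // scale1r. Qed.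
Let scaleDr : right_distributive scale add.
Proof.
move=> k t u; apply: tensorP => W f Hf.
by rewrite liftZ ?liftD ?liftZ // scalerDr.
Qed.
Let scaleDl t k l : scale (k + l) t = add (scale k t) (scale l t).
Proof. by apply: tensorP => W f Hf; rewrite liftD ?liftZ // scalerDl. Qed.

HB.instance Definition _ :=
  GRing.Zmodule_isLmodule.Build R tensor scaleA scale1 scaleDr scaleDl.

Let eq_lift (W : lmodType R) (f g : A -> B -> W) t :
  (forall a b, f a b = g a b) -> tensor_lift f t = tensor_lift g t.
Proof. by move=> fg; apply: eq_bigr => p _; apply: fg. Qed.

Let mulA : associative mul.
Proof.
move=> t u v; apply: tensorP => W f Hf.
rewrite !liftM //; last exact: bil_mulr.
apply: eq_lift => a b; rewrite liftM; last exact: bil_mull.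
by apply: eq_lift => a' b'; apply: eq_lift => a'' b''; rewrite !mulrA.
Qed.
Let mul1 : left_id one mul.
Proof.
move=> t; apply: tensorP => W f Hf; rewrite liftM // lift1; last exact: bil_mulr.
by apply: eq_lift => a b; rewrite !mul1r.
Qed.
Let mulr1' : right_id one mul.
Proof.
move=> t; apply: tensorP => W f Hf; rewrite liftM //.
by apply: eq_lift => a b; rewrite lift1 ?mulr1 //; apply: bil_mull.
Qed.
Let mulDl : left_distributive mul add.
Proof.
move=> t u v; apply: tensorP => W f Hf.
by rewrite liftD // !liftM // liftD //; apply: bil_mulr.
Qed.
Let mulDr : right_distributive mul add.
Proof.
move=> t u v; apply: tensorP => W f Hf.
rewrite liftD // !liftM // /tensor_lift -big_split; apply: eq_bigr => p _.
by rewrite -[LHS]/(tensor_lift _ (add u v)) liftD //; apply: bil_mull.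
Qed.

HB.instance Definition _ :=
  GRing.Zmodule_isPzRing.Build tensor mulA mul1 mulr1' mulDl mulDr.

Lemma tensor_scaleAl k (t u : tensor) : k *: (t * u) = (k *: t) * u.
Proof.
suff : scale k (mul t u) = mul (scale k t) u by [].
apply: tensorP => W f Hf.
by rewrite liftZ // !liftM // liftZ //; apply: bil_mulr.
Qed.

Lemma tensor_scaleAr k (t u : tensor) : k *: (t * u) = t * (k *: u).
Proof.
suff : scale k (mul t u) = mul t (scale k u) by [].
apply: tensorP => W f Hf.
rewrite liftZ // !liftM // /tensor_lift scaler_sumr; apply: eq_bigr => p _.
by rewrite -[RHS]/(tensor_lift _ (scale k u)) liftZ //; apply: bil_mull.
Qed.

Lemma tensor_lift_linear (W : lmodType R) (f : A -> B -> W) :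
  is_bilinear f -> linear (tensor_lift f).
Proof.
move=> Hf k t u.
suff : tensor_lift f (add (scale k t) u) = k *: tensor_lift f t + tensor_lift f u.
  by [].
by rewrite liftD // liftZ.
Qed.

Lemma tensor_lift_tens (W : lmodType R) (f : A -> B -> W) a b :
  is_bilinear f -> tensor_lift f (tens a b) = f a b.
Proof. by move=> Hf; rewrite tensor_liftE // /formal_sum big_seq1. Qed.

Lemma tensor1E : 1 = tens 1 1.
Proof. by []. Qed.

Lemma tensM a b a' b' : tens a b * tens a' b' = tens (a * a') (b * b').
Proof.
suff : mul (tens a b) (tens a' b') = tens (a * a') (b * b') by [].
apply: tensorP => W f Hf.
rewrite liftM // !tensor_lift_tens //; first exact: bil_mull.
exact: bil_mulr.
Qed.

Lemma tens_bilinear : is_bilinear tens.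
Proof.
split=> [b|a] k c d /=.
  suff : tens (k *: c + d) b = add (scale k (tens c b)) (tens d b) by [].
  apply: tensorP => W f Hf.
  by rewrite liftD // liftZ // !tensor_lift_tens //; apply: Hf.1.
suff : tens a (k *: c + d) = add (scale k (tens a c)) (tens a d) by [].
apply: tensorP => W f Hf.
by rewrite liftD // liftZ // !tensor_lift_tens //; apply: Hf.2.
Qed.

Lemma tensX a b k : tens a b ^+ k = tens (a ^+ k) (b ^+ k).
Proof. by elim: k => [|k IHk]; rewrite ?tensor1E // !exprS IHk tensM. Qed.

End Tensor.

Arguments tens {R A B} a b.

Section QBinomial.
Variables (F : fieldType) (q : F).

Fixpoint qbinom (k i : nat) : F :=
  match k, i with
  | _, 0 => 1
  | 0, _.+1 => 0
  | k'.+1, i'.+1 => qbinom k' i' + q ^+ i * qbinom k' i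
  end.

Lemma qbinom0 k : qbinom k 0 = 1. Proof. by case: k. Qed.

Lemma qbinomS k i :
  qbinom k.+1 i.+1 = qbinom k i + q ^+ i.+1 * qbinom k i.+1.
Proof. by []. Qed.

Lemma qbinom_small k i : (k < i)%N -> qbinom k i = 0.
Proof.
elim: k i => [|k IHk] [|i] // ki; rewrite qbinomS !IHk ?mulr0 ?addr0 //.
exact: ltnW.
Qed.

Lemma qbinomnn k : qbinom k k = 1.
Proof. by elim: k => // k IHk; rewrite qbinomS IHk qbinom_small ?mulr0 ?addr0. Qed.

Let qbinom_absorb k i : (i <= k)%N ->
  (1 - q ^+ i.+1) * qbinom k i.+1 = (1 - q ^+ (k - i)) * qbinom k i ->
  (1 - q ^+ i.+1) * qbinom k.+1 i.+1 = (1 - q ^+ k.+1) * qbinom k i.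
Proof.
move=> ik E; rewrite qbinomS mulrDr mulrCA E.
have -> : q ^+ k.+1 = q ^+ i.+1 * q ^+ (k - i) by rewrite -exprD addSn subnKC.
by ring.
Qed.

Let qbinom_ratio k i : (i <= k)%N ->
  (1 - q ^+ i.+1) * qbinom k i.+1 = (1 - q ^+ (k - i)) * qbinom k i.
Proof.
elim: k i => [|k IHk] i; first by rewrite leqn0 => /eqP ->; rewrite subrr mulr0 mul0r.
rewrite leq_eqVlt => /predU1P [->|].
  by rewrite qbinom_small // subnn subrr mulr0 mul0r.
rewrite ltnS => ik; rewrite qbinom_absorb ?IHk //.
case: i ik => [|i] ik; first by rewrite subn0 !qbinom0.
rewrite subSS qbinomS mulrDr -IHk 1?ltnW // mulrCA.
have -> : q ^+ k.+1 = q ^+ i.+1 * q ^+ (k - i) by rewrite -exprD addSn subnKC // ltnW.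
by ring.
Qed.

Lemma qbinom_prim n i : n.-primitive_root q -> (0 < i < n)%N -> qbinom n i = 0.
Proof.
case: n i => [|n] [|i] // prim_q /andP [_ i_n].
have ik : (i <= n)%N by apply: ltnW.
have /eqP := qbinom_absorb ik (qbinom_ratio ik).
rewrite (prim_expr_order prim_q) subrr mul0r mulf_eq0 subr_eq0 => /orP[|/eqP //].
rewrite eq_sym -(prim_order_dvd prim_q) => /(dvdn_leq (ltn0Sn _)).
by rewrite leqNgt i_n.
Qed.

Variables (B : algType F) (P Q : B).
Hypothesis PQ : P * Q = q *: (Q * P).

Let PXQ i : P * Q ^+ i = q ^+ i *: (Q ^+ i * P).
Proof.
elim: i => [|i IHi]; first by rewrite scale1r mulr1 mul1r.
by rewrite exprSr mulrA IHi -scalerAl -(mulrA _ P) PQ -scalerAr scalerA mulrA -(exprSr q).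
Qed.

Lemma qbinomial k :
  (P + Q) ^+ k = \sum_(i < k.+1) qbinom k i *: (Q ^+ i * P ^+ (k - i)).
Proof.
elim: k => [|k IHk]; first by rewrite big_ord1 scale1r mulr1.
rewrite exprS {}IHk mulrDl !mulr_sumr.
rewrite big_ord_recl [X in X + _ = _]addrC.
rewrite [in RHS]big_ord_recl /= qbinom0 !scale1r expr0 !mul1r subn0.
rewrite [in RHS](eq_bigr (fun i : 'I_k.+1 =>
  qbinom k i *: (Q * (Q ^+ i * P ^+ (k - i)))
  + (q ^+ i.+1 * qbinom k i.+1) *: (Q ^+ i.+1 * P ^+ (k - i)))); last first.
  by move=> i _; rewrite /bump /= add1n subSS scalerDl mulrA -exprS.
rewrite big_split /= [X in _ = _ + (_ + X)]big_ord_recr /=.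
rewrite qbinom_small // mulr0 scale0r addr0.
rewrite subn0 exprS [X in X + _ = _]addrC -addrA; congr (_ + _).
rewrite addrC; congr (_ + _).
  by apply: eq_bigr => i _; rewrite -scalerAr.
apply: eq_bigr => i _; rewrite /bump /= add1n -scalerAr mulrA PXQ.
rewrite -scalerAl scalerA mulrC -mulrA -exprS; congr (_ *: (_ * P ^+ _)).
by rewrite subnSK.
Qed.

Lemma qcomm_exprn0 n : n.-primitive_root q ->
  P ^+ n = 0 -> Q ^+ n = 0 -> (P + Q) ^+ n = 0.
Proof.
move=> prim_q P0 Q0; rewrite qbinomial big1 // => i _.
have [->|i_gt0] := posnP i; first by rewrite subn0 P0 mulr0 scaler0.
have [i_n|] := ltnP i n; first by rewrite qbinom_prim ?scale0r ?i_gt0.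
move=> n_i; have -> : i = n :> nat by apply/eqP; rewrite eqn_leq n_i -ltnS ltn_ord.
by rewrite Q0 mul0r scaler0.
Qed.

End QBinomial.

Opaque uq_pi.

Section ComultiplicationRelators.
Variables (F : fieldType) (n : nat) (w : F).
Variables (odd_n : odd n) (prim_w : n.-primitive_root w).
Variables (B : algType F) (a x y : B).
Hypothesis rel : {in uq_relators n w a x y, forall r, r = 0}.

Local Notation a' := (a ^+ n.-1).

Let n_gt0 : (0 < n)%N. Proof. by case: (n) odd_n. Qed.

Let rel_nth k : nth 0 (uq_relators n w a x y) k = 0.
Proof.
have [kn|kn] := ltnP k (size (uq_relators n w a x y)).
  exact: rel (mem_nth 0 kn).
exact: nth_default.
Qed.

Lemma uq_rel_aX : a ^+ n = 1. Proof. exact: subr0_eq (rel_nth 0). Qed.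
Lemma uq_rel_xX : x ^+ n = 0. Proof. exact: rel_nth 1. Qed.
Lemma uq_rel_yX : y ^+ n = 0. Proof. exact: rel_nth 2. Qed.
Lemma uq_rel_ax : a * x = w ^+ 2 *: (x * a).
Proof. exact: subr0_eq (rel_nth 3). Qed.
Lemma uq_rel_ay : a * y = w ^- 2 *: (y * a).
Proof. exact: subr0_eq (rel_nth 4). Qed.
Lemma uq_rel_xy : x * y - y * x = a - a'.
Proof. exact: subr0_eq (rel_nth 5). Qed.

Lemma uq_rel_aV : a * a' = 1.
Proof. by rewrite -exprS prednK // uq_rel_aX. Qed.
Lemma uq_rel_Va : a' * a = 1.
Proof. by rewrite -exprSr prednK // uq_rel_aX. Qed.

Let w2_neq0 : w ^+ 2 != 0.
Proof.
apply: expf_neq0; apply/eqP => w0; have := prim_expr_order prim_w.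
by rewrite w0 expr0n eqn0Ngt n_gt0 => /eqP; rewrite eq_sym oner_eq0.
Qed.

Lemma uq_rel_xV : x * a' = w ^+ 2 *: (a' * x).
Proof.
have -> : x * a' = a' * (a * x) * a' by rewrite mulrA uq_rel_Va mul1r.
by rewrite uq_rel_ax -scalerAr -scalerAl -!mulrA uq_rel_aV mulr1.
Qed.

Lemma uq_rel_Vy : a' * y = w ^+ 2 *: (y * a').
Proof.
have -> : y * a' = a' * (a * y) * a' by rewrite mulrA uq_rel_Va mul1r.
rewrite uq_rel_ay -scalerAr -scalerAl -!mulrA uq_rel_aV mulr1.
by rewrite scalerA divff // scale1r.
Qed.

Variables (T : algType F) (t : B -> B -> T).
Hypothesis t_bil : is_bilinear t.
Hypothesis tM : forall g h g' h', t g h * t g' h' = t (g * g') (h * h').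
Hypothesis t1 : t 1 1 = 1.

Let tX g h k : t g h ^+ k = t (g ^+ k) (h ^+ k).
Proof. by elim: k => [|k IHk]; rewrite ?t1 // !exprS IHk tM. Qed.

Let prim_w2 : n.-primitive_root (w ^+ 2).
Proof.
have := exp_prim_root prim_w 2; rewrite (_ : gcdn 2 n = 1%N) ?divn1 //.
by apply/eqP; rewrite -/(coprime 2 n) coprime2n.
Qed.

Lemma uq_comul_relators :
  {in uq_relators n w (t a a) (t x a + t 1 x) (t y 1 + t a' y),
    forall r, r = 0}.
Proof.
move=> r; rewrite !inE => /or4P [||| /or3P []] /eqP ->.
- by rewrite tX uq_rel_aX t1 subrr.
- apply: (qcomm_exprn0 _ prim_w2).
  + by rewrite !tM mulr1 mul1r uq_rel_ax bilinearZr.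
  + by rewrite tX uq_rel_xX bilinear0l.
  + by rewrite tX uq_rel_xX bilinear0r.
- rewrite addrC; apply: (qcomm_exprn0 _ prim_w2).
  + by rewrite !tM mulr1 mul1r uq_rel_Vy bilinearZl.
  + by rewrite tX uq_rel_yX bilinear0r.
  + by rewrite tX uq_rel_yX bilinear0l.
- rewrite mulrDr mulrDl !tM mulr1 mul1r uq_rel_ax bilinearZl // bilinearZr //.
  by rewrite scalerDr subrr.
- rewrite mulrDr mulrDl !tM mulr1 mul1r uq_rel_aV uq_rel_Va uq_rel_ay.
  by rewrite bilinearZl // bilinearZr // scalerDr subrr.
have xyE : x * y = y * x + (a - a') by rewrite -uq_rel_xy addrC subrK.
have tNl g h : t (- g) h = - t g h by rewrite -!scaleN1r bilinearZl.
have tNr g h : t g (- h) = - t g h by rewrite -!scaleN1r bilinearZr.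
have e : t (x * a') (a * y) = t (a' * x) (y * a).
  rewrite uq_rel_xV uq_rel_ay bilinearZl // bilinearZr // scalerA divff //.
  exact: scale1r.
rewrite !(mulrDr, mulrDl) !tM !mulr1 !mul1r e xyE tX.
rewrite !(bilinearDl t_bil, bilinearDr t_bil, tNl, tNr).
rewrite !opprD !opprK !addrA.
rewrite [LHS](ACl (1*9*(2*13)*(3*7)*(4*11)*(5*10)*(6*12)*(8*14))%AC) /=.
by rewrite !(subrr, addNr) !addr0.
Qed.

End ComultiplicationRelators.

Section Comultiplication.
Variables (F : fieldType) (n : nat) (w : F).
Variables (odd_n : odd n) (prim_w : n.-primitive_root w).
Local Notation H := (uqsl2 odd_n prim_w).
Local Notation a := (uq_a odd_n prim_w).
Local Notation x := (uq_x odd_n prim_w).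
Local Notation y := (uq_y odd_n prim_w).

Let counit2_bil :
  is_bilinear (fun g h : H => (uq_counit g * uq_counit h : F^o)).
Proof.
split=> [h|g] k c d /=; rewrite [uq_counit (_ *: _ + _)]linearP /=.
  by rewrite mulrDl -scalerAl.
by rewrite mulrDr -scalerAr.
Qed.

Let tensor_one_neq0 : 1 != 0 :> tensor H H.
Proof.
apply/eqP => one0; have := tensor_lift_tens 1 1 counit2_bil.
rewrite -tensor1E one0 rmorph1 mulr1.
have := tensor_lift_linear counit2_bil (-1) 0 0.
rewrite scaler0 addr0 scaleN1r addNr => -> /eqP.
by rewrite eq_sym oner_eq0.
Qed.

HB.instance Definition _ :=
  GRing.PzSemiRing_isNonZero.Build (tensor H H) tensor_one_neq0.
HB.instance Definition _ :=
  GRing.Lmodule_isLalgebra.Build F (tensor H H) (@tensor_scaleAl F H H).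
HB.instance Definition _ :=
  GRing.Lalgebra_isAlgebra.Build F (tensor H H) (@tensor_scaleAr F H H).

Definition uq_comul_letter (i : 'I_3) : tensor H H :=
  if i == 0 then tens a a
  else if i == 1 then tens x a + tens 1 x
  else tens y 1 + tens (a ^+ n.-1) y.

Lemma uq_comul_rel :
  {in uq_relators n w (uq_comul_letter 0) (uq_comul_letter 1)
        (uq_comul_letter 2), forall r, r = 0}.
Proof.
exact: (uq_comul_relators odd_n prim_w (@uq_relE F n w odd_n prim_w)
  (tens_bilinear H H) (@tensM F H H) (esym (tensor1E H H))).
Qed.

Definition uq_comul : H -> tensor H H := uq_lift uq_comul_rel.
HB.instance Definition _ := GRing.LRMorphism.on uq_comul.

Lemma uq_comul_a : uq_comul a = tens a a.
Proof. exact: uq_lift_a. Qed.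
Lemma uq_comul_x : uq_comul x = tens x a + tens 1 x.
Proof. exact: uq_lift_x. Qed.
Lemma uq_comul_y : uq_comul y = tens y 1 + tens (a ^+ n.-1) y.
Proof. exact: uq_lift_y. Qed.

Lemma uq_counit_a : uq_counit a = 1.
Proof. exact: uq_lift_a. Qed.
Lemma uq_counit_x : uq_counit x = 0.
Proof. exact: uq_lift_x. Qed.
Lemma uq_counit_y : uq_counit y = 0.
Proof. exact: uq_lift_y. Qed.

End Comultiplication.

Section Actions.
Variables (F : fieldType) (n : nat) (w : F).
Variables (odd_n : odd n) (prim_w : n.-primitive_root w).
Local Notation H := (uqsl2 odd_n prim_w).

(* Sweedler notation: sweedler f h is the sum of the f h_(1) h_(2); it is only
   used with bilinear f. *)
Definition sweedler (W : nmodType) (f : H -> H -> W) (h : H) : W :=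
  tensor_lift f (uq_comul h).

Variable A : algType F.

Definition module_algebra (act : H -> A -> A) : Prop :=
  is_bilinear act
  /\ [/\ forall b, act 1 b = b,
         forall g h b, act (g * h) b = act g (act h b),
         forall h, act h 1 = uq_counit h *: 1
       & forall h b c,
           act h (b * c) = sweedler (fun h1 h2 => act h1 b * act h2 c) h].

Definition convolution (u v : H -> A) (h : H) : A :=
  sweedler (fun h1 h2 => u h1 * v h2) h.

Definition convolution_inverse (u v : H -> A) : Prop :=
  forall h, convolution u v h = uq_counit h *: 1
         /\ convolution v u h = uq_counit h *: 1.

Definition inner_via (act : H -> A -> A) (u : {linear H -> A}) : Prop :=
  u 1 = 1 /\
  exists2 v : {linear H -> A}, convolution_inverse u v &
    forall h b, act h b = sweedler (fun h1 h2 => u h1 * b * v h2) h.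

End Actions.

(* Main.v *)
(**
  Since [A] is a matrix algebra, Skolem-Noether gives [G] with [a*b = G b G^-1].
  Put [z = x a^-1]; both [y] and [z] are (1, a^-1)-skew-primitive, hence act by
  skew derivations, which are inner: [y*b = Y b - G^-1 b G Y] and likewise for
  [z] with some [Z].  These elements are unique up to multiples of [G^-1], and
  exactly one choice satisfies [G Y = w^-2 Y G], [G Z = w^2 Z G].  The relations
  of [H] then make [G^n], [Y^n], [Z^n] and [G^2 (Z Y - w^2 Y Z - w^2)] central,
  hence scalar.

  By the PBW theorem there is a linear [u] with
  [u (y^j z^i a^k) = Y^j Z^i G^k] for [j, i, k < n].  Each of [span (y^j)],
  [span (z^i)], [F a^k] is a left coideal, so the identity
  [sum (h_(1) * b) u(h_(2)) = u(h) b] can be checked factor by factor; it is the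
  inner-action formula as soon as [u] is convolution invertible.  The latter
  holds because [u] takes invertible values on the group-like elements and the
  comultiplication is triangular with respect to the degree [j + i].
*)
Require Import Defs.
From HB Require Import structures.
From mathcomp Require Import all_boot all_order all_algebra.
From mathcomp Require Import ring zify.

Set Implicit Arguments.
Unset Strict Implicit.
Unset Printing Implicit Defensive.

Import GRing.Theory.
Local Open Scope ring_scope.

(** * Tensor products and Sweedler sums *)

Section TensorLift.
Variables (R : comNzRingType) (A B : algType R).

Lemma tensor_lift_sum (W : lmodType R) (f : A -> B -> W) (I : Type)
    (s : seq I) (t : I -> tensor A B) :
  is_bilinear f -> tensor_lift f (\sum_(i <- s) t i) = \sum_(i <- s) tensor_lift f (t i).
Proof.
move=> Hf; have L := tensor_lift_linear Hf; have L0 : tensor_lift f 0 = 0.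
  by have := L (-1) 0 0; rewrite scaler0 addr0 scaleN1r addNr.
elim: s => [|i s IHs]; first by rewrite !big_nil.
by rewrite !big_cons -[t i]scale1r L !scale1r IHs.
Qed.

Lemma tensor_sumE (s : seq (A * B)) : tensor_sum s = \sum_(p <- s) tens p.1 p.2.
Proof.
apply: tensorP => W f Hf; rewrite tensor_lift_sum // tensor_liftE //.
by apply: eq_bigr => p _; rewrite tensor_lift_tens.
Qed.

Lemma bilinear_mull (W : lmodType R) (f : A -> B -> W) g g' :
  is_bilinear f -> is_bilinear (fun h h' => f (g * h) (g' * h')).
Proof.
by move=> [f1 f2]; split=> [h'|h] k c d /=; rewrite mulrDr -scalerAr ?f1 ?f2.
Qed.

Lemma tensor_lift_mull (W : lmodType R) (f : A -> B -> W) g g' (t : tensor A B) :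
  is_bilinear f ->
  tensor_lift f (tens g g' * t) = tensor_lift (fun h h' => f (g * h) (g' * h')) t.
Proof.
move=> Hf; rewrite -{1}(reprK t) -/(tensor_sum (repr t)) tensor_sumE mulr_sumr.
rewrite tensor_lift_sum //; apply: eq_bigr => p _.
by rewrite tensM tensor_lift_tens.
Qed.

End TensorLift.

Section Sweedler.
Variables (F : fieldType) (n : nat) (w : F).
Variables (odd_n : odd n) (prim_w : n.-primitive_root w).
Local Notation H := (uqsl2 odd_n prim_w).
Local Notation a := (uq_a odd_n prim_w).
Local Notation x := (uq_x odd_n prim_w).
Local Notation y := (uq_y odd_n prim_w).
Local Notation a' := (a ^+ n.-1).

Lemma sweedler_ext (W : nmodType) (f g : H -> H -> W) h :
  (forall h1 h2, f h1 h2 = g h1 h2) -> sweedler f h = sweedler g h.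
Proof. by move=> fg; apply: eq_bigr => p _; apply: fg. Qed.

Section Bilinear.
Variables (W : lmodType F) (f : H -> H -> W).
Hypothesis Hf : is_bilinear f.

Lemma sweedler_linear : linear (sweedler f).
Proof. by move=> k g h; rewrite /sweedler linearP; apply: tensor_lift_linear. Qed.

Lemma sweedler1 : sweedler f 1 = f 1 1.
Proof. by rewrite /sweedler rmorph1 tensor1E tensor_lift_tens. Qed.

(** The comultiplication is multiplicative, so a generator on the left can be absorbed into the
    bilinear map; this rule and those for [x] and [y] drive the later inductions on Sweedler
    sums. *)
Lemma sweedler_aX k h :
  sweedler f (a ^+ k * h) = sweedler (fun g g' => f (a ^+ k * g) (a ^+ k * g')) h.
Proof. by rewrite /sweedler rmorphM rmorphXn /= uq_comul_a tensX tensor_lift_mull. Qed.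

Let lift_mulD g g' k k' t :
  tensor_lift f ((tens g g' + tens k k') * t) =
  tensor_lift (fun h h' => f (g * h) (g' * h')) t
  + tensor_lift (fun h h' => f (k * h) (k' * h')) t.
Proof.
rewrite mulrDl -{1}[_ * t]scale1r (tensor_lift_linear Hf) scale1r.
by rewrite !tensor_lift_mull.
Qed.

Lemma sweedler_x h : sweedler f (x * h) =
  sweedler (fun g g' => f (x * g) (a * g')) h + sweedler (fun g g' => f g (x * g')) h.
Proof.
rewrite /sweedler rmorphM /= uq_comul_x lift_mulD; congr (_ + _).
by apply: sweedler_ext => g g'; rewrite mul1r.
Qed.

Lemma sweedler_y h : sweedler f (y * h) =
  sweedler (fun g g' => f (y * g) g') h + sweedler (fun g g' => f (a' * g) (y * g')) h.
Proof.
rewrite /sweedler rmorphM /= uq_comul_y lift_mulD; congr (_ + _).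
by apply: sweedler_ext => g g'; rewrite mul1r.
Qed.

End Bilinear.

End Sweedler.

(** * Monomials in quantum sl2 *)

Section QCommutation.
Variables (F : fieldType) (B : algType F) (q : F).

Lemma qcomm_exprr (a x : B) k : a * x = q *: (x * a) -> a * x ^+ k = q ^+ k *: (x ^+ k * a).
Proof.
move=> ax; elim: k => [|k IHk]; first by rewrite scale1r mulr1 mul1r.
by rewrite exprSr mulrA IHk -scalerAl -(mulrA _ a) ax -scalerAr scalerA mulrA -!exprSr.
Qed.

Lemma qcomm_exprl (a x : B) k : a * x = q *: (x * a) -> a ^+ k * x = q ^+ k *: (x * a ^+ k).
Proof.
move=> ax; elim: k => [|k IHk]; first by rewrite scale1r mulr1 mul1r.
rewrite exprS -(mulrA a) IHk -scalerAr (mulrA a x) ax -scalerAl scalerA -exprSr.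
by rewrite -mulrA.
Qed.

(** A new [x] crosses [a ^+ k] at cost [q ^+ k]; these exponents add up to the binomial
    coefficient. *)
Lemma qcomm_exprM (a x : B) k : a * x = q *: (x * a) ->
  (x * a) ^+ k = q ^+ 'C(k, 2) *: (x ^+ k * a ^+ k).
Proof.
move=> ax; elim: k => [|k IHk]; first by rewrite scale1r mulr1.
rewrite exprSr IHk -scalerAl -mulrA (mulrA (a ^+ k)) (qcomm_exprl _ ax).
rewrite -scalerAl -scalerAr scalerA -exprD binS bin1 (mulrA (x ^+ k)).
by rewrite mulrA -exprSr -mulrA -exprSr addnC.
Qed.

End QCommutation.

Section PrimitiveRoot.
Variables (F : fieldType) (n : nat) (w : F).
Hypotheses (odd_n : odd n) (prim_w : n.-primitive_root w).

Lemma prim_root_neq0 : w != 0.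
Proof. by rewrite (prim_root_eq0 prim_w) -lt0n (prim_order_gt0 prim_w). Qed.

Lemma prim_root_sqr : n.-primitive_root (w ^+ 2).
Proof. by rewrite (prim_root_exp_coprime _ prim_w) coprime2n. Qed.

Lemma prim_root_inv : n.-primitive_root w^-1.
Proof.
have n_gt0 := prim_order_gt0 prim_w.
have -> : w^-1 = w ^+ n.-1.
  apply: (mulfI prim_root_neq0).
  by rewrite -exprS prednK // (prim_expr_order prim_w) divff // prim_root_neq0.
by rewrite (prim_root_exp_coprime _ prim_w) coprimePn.
Qed.

End PrimitiveRoot.

(** * The PBW monomials span *)

Section Pbw.
Variables (F : fieldType) (n : nat) (w : F).
Variables (odd_n : odd n) (prim_w : n.-primitive_root w).
Variables (B : algType F) (a x y : B).
Hypothesis rel : {in uq_relators n w a x y, forall r, r = 0}.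
Local Notation a' := (a ^+ n.-1).
Local Notation z := (x * a').
Local Notation q := (w ^+ 2).

Let n_gt0 : (0 < n)%N. Proof. exact: prim_order_gt0 prim_w. Qed.

Lemma uq_rel_za : z * a = x.
Proof. by rewrite -mulrA (uq_rel_Va odd_n rel) mulr1. Qed.

Lemma uq_rel_az : a * z = q *: (z * a).
Proof.
by rewrite mulrA (uq_rel_ax rel) -scalerAl -!mulrA (uq_rel_aV odd_n rel) (uq_rel_Va odd_n rel).
Qed.

(** Moving [a'] across [y] costs [q], and the commutator of [x] and [y] supplies the correction.
    This rule brings products into PBW order. *)
Lemma uq_rel_zy : z * y = q *: (y * z) + q *: (1 - a' * a').
Proof.
have xyE : x * y = y * x + (a - a') by rewrite -(uq_rel_xy rel) addrC subrK.
rewrite -mulrA (uq_rel_Vy odd_n prim_w rel) -scalerAr (mulrA x) xyE mulrDl mulrBl.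
by rewrite (uq_rel_aV odd_n rel) scalerDr -(mulrA y).
Qed.

Lemma uq_rel_zX : z ^+ n = 0.
Proof.
have ax : x * a' = q *: (a' * x) := uq_rel_xV odd_n rel.
by rewrite ax exprZn (qcomm_exprM _ ax) (uq_rel_xX rel) mulr0 !scaler0.
Qed.

(* With z rather than x, the second tensor factors of the comultiplication of
   pbw j i k are spanned by monomials pbw l m k with the same exponent k. *)
Definition pbw j i k : B := y ^+ j * z ^+ i * a ^+ k.

Lemma pbw0 : pbw 0 0 0 = 1. Proof. by rewrite /pbw !mulr1. Qed.

Lemma pbw_y j i k : y * pbw j i k = pbw j.+1 i k.
Proof. by rewrite /pbw exprS !mulrA. Qed.

Lemma pbw_z i k : z * pbw 0 i k = pbw 0 i.+1 k.
Proof. by rewrite /pbw exprS !mul1r !mulrA. Qed.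

Lemma pbw_a j i k : a * pbw j i k = (q ^+ i / q ^+ j) *: pbw j i k.+1.
Proof.
rewrite /pbw !(mulrA a) (qcomm_exprr _ (uq_rel_ay rel)) -!scalerAl -(mulrA _ a).
rewrite (qcomm_exprr _ uq_rel_az) -scalerAr -scalerAl scalerA -!mulrA -exprS.
by rewrite mulrC exprVn.
Qed.

Lemma pbw_mod j i k : pbw j i (k %% n) = pbw j i k.
Proof. by rewrite /pbw (expr_mod _ (uq_rel_aX rel)). Qed.

Lemma pbw_big j i k : (n <= j)%N || (n <= i)%N -> pbw j i k = 0.
Proof.
rewrite /pbw; case/orP => [nj|ni].
  by rewrite -(subnK nj) exprD (uq_rel_yX rel) !(mulr0, mul0r).
by rewrite -(subnK ni) exprD uq_rel_zX !(mulr0, mul0r).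
Qed.

Hypothesis B_ind : forall P : B -> Prop,
  P 1 -> (forall k h, P h -> P (k *: h)) ->
  (forall g h, P g -> P h -> P (g + h)) ->
  (forall h, P h -> P (a * h)) -> (forall h, P h -> P (x * h)) ->
  (forall h, P h -> P (y * h)) -> forall h, P h.

(* Left multiplication by a generator is absorbed into the predicate, which is
   therefore kept general in every induction below. *)
Lemma pbw_ind (P : B -> Prop) :
  (forall k g h, P g -> P h -> P (k *: g + h)) -> (forall j i k, P (pbw j i k)) ->
  forall h, P h.
Proof.
move=> PL Pe h.
have mul (Q : B -> Prop) (g : B) : (forall k g h, Q g -> Q h -> Q (k *: g + h)) ->
    forall k h h', Q (g * h) -> Q (g * h') -> Q (g * (k *: h + h')).
  by move=> QL k h1 h2 Q1 Q2; rewrite mulrDr -scalerAr; apply: QL.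
(* Zero is itself a monomial, one whose exponent of [y] is [n]. *)
have L0 (Q : B -> Prop) : (forall k g h, Q g -> Q h -> Q (k *: g + h)) ->
    (forall j i k, Q (pbw j i k)) -> Q 0.
  by move=> QL Qe; rewrite -(@pbw_big n 0 0) ?leqnn.
have LZ (Q : B -> Prop) : (forall k g h, Q g -> Q h -> Q (k *: g + h)) ->
    (forall j i k, Q (pbw j i k)) -> forall k g, Q g -> Q (k *: g).
  by move=> QL Qe k g Qg; rewrite -[_ *: _]addr0; apply: (QL) => //; apply: (L0 Q).
have LD (Q : B -> Prop) : (forall k g h, Q g -> Q h -> Q (k *: g + h)) ->
    forall g g', Q g -> Q g' -> Q (g + g').
  by move=> QL g g' Qg Qg'; rewrite -[g]scale1r; apply: QL.
have Qa (Q : B -> Prop) : (forall k g h, Q g -> Q h -> Q (k *: g + h)) ->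
    (forall j i k, Q (pbw j i k)) -> forall j i k, Q (a * pbw j i k).
  by move=> QL Qe j i k; rewrite pbw_a; apply: LZ.
have Qaa (Q : B -> Prop) m : (forall k g h, Q g -> Q h -> Q (k *: g + h)) ->
    (forall j i k, Q (pbw j i k)) -> forall j i k, Q (a ^+ m * pbw j i k).
  elim: m Q => [|m IHm] Q QL Qe j i k; first by rewrite mul1r.
  rewrite exprSr -mulrA; move: j i k; apply: (Qa (fun h => Q (a ^+ m * h))).
    exact: (mul Q).
  exact: IHm.
(* Induction on the power of [y]: [uq_rel_zy] moves [z] one place inward, and its correction
   involves only powers of [a], handled by [Qaa]. *)
have Qz (Q : B -> Prop) : (forall k g h, Q g -> Q h -> Q (k *: g + h)) ->
    (forall j i k, Q (pbw j i k)) -> forall j i k, Q (z * pbw j i k).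
  move=> QL Qe j i k; elim: j Q QL Qe => [|j IHj] Q QL Qe; first by rewrite pbw_z.
  rewrite -pbw_y mulrA uq_rel_zy mulrDl -!scalerAl -mulrA; apply: (QL).
    apply: (IHj (fun h => Q (y * h))); first exact: (mul Q).
    by move=> *; rewrite pbw_y.
  apply: LZ => //; rewrite -exprD mulrBl mul1r addrC -scaleN1r; apply: (QL) => //.
  exact: (Qaa Q).
elim/B_ind: h P PL Pe => [|k h IH|g h IHg IHh|h IH|h IH|h IH] P PL Pe.
- by rewrite -pbw0.
- by apply: LZ => //; apply: IH.
- by apply: LD => //; [apply: IHg|apply: IHh].
- by apply: (IH (fun h => P (a * h))); [apply: (mul P)|apply: Qa].
- rewrite -uq_rel_za -mulrA; apply: (IH (fun h => P (z * (a * h)))).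
    by move=> k g1 g2 P1 P2; rewrite mulrDr -scalerAr; apply: (mul P).
  apply: (Qa (fun h => P (z * h))); first exact: (mul P).
  exact: Qz.
- apply: (IH (fun h => P (y * h))); first exact: (mul P).
  by move=> *; rewrite pbw_y.
Qed.

Lemma pbw_small_ind (P : B -> Prop) :
  (forall k g h, P g -> P h -> P (k *: g + h)) ->
  (forall j i k, (j < n)%N -> (i < n)%N -> (k < n)%N -> P (pbw j i k)) ->
  forall h, P h.
Proof.
move=> PL Pe; apply: pbw_ind => // j i k; rewrite -pbw_mod.
have kn : (k %% n < n)%N by rewrite ltn_mod.
(* Overflowing monomials vanish, and zero is the combination [- p + p] with [p] the monomial 1. *)
have [jn|nj] := ltnP j n; last first.
  rewrite pbw_big ?nj // -(addNr (pbw 0 0 0)) -scaleN1r.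
  by apply: PL; apply: Pe.
have [i_n|ni] := ltnP i n; first exact: Pe.
rewrite pbw_big ?ni ?orbT // -(addNr (pbw 0 0 0)) -scaleN1r.
by apply: PL; apply: Pe.
Qed.

End Pbw.

(** * The regular representation *)

Lemma prim_root_sum (F : fieldType) n (q : F) :
  n.-primitive_root q -> (1 < n)%N -> \sum_(t < n) q ^+ t = 0.
Proof.
move=> prim_q n_gt1.
have : (q - 1) * (\sum_(t < n) q ^+ t) = 0 by rewrite -subrX1 prim_expr_order ?subrr.
move/eqP; rewrite mulf_eq0 subr_eq0 => /orP[|/eqP //].
by have := prim_order_dvd prim_q 1; rewrite expr1 dvdn1 gtn_eqF // => <-.
Qed.

(** The commutator of [x ^+ m] with [y] has as coefficients the quantum integers of [m] at [q] and
    at [q^-1]; both vanish for [m = n]. *)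
Lemma uq_comm_xn (F : fieldType) (B : algType F) n (q : F) (a a' x y : B) :
  n.-primitive_root q -> (1 < n)%N -> a * a' = 1 -> a' * a = 1 ->
  a * x = q *: (x * a) -> x * y - y * x = a - a' -> x ^+ n * y = y * x ^+ n.
Proof.
move=> prim_q n_gt1 aV Va ax xy.
have q_neq0 := prim_root_neq0 prim_q.
have a'x : a' * x = q^-1 *: (x * a').
  have xa : x * a = q^-1 *: (a * x) by rewrite ax scalerA mulVf // scale1r.
  have -> : a' * x = a' * (x * a) * a' by rewrite -!mulrA aV mulr1.
  by rewrite xa -scalerAr -scalerAl !mulrA Va mul1r.
have comm m : x ^+ m * y - y * x ^+ m =
    (\sum_(t < m) q ^+ t) *: (x ^+ m.-1 * a) - (\sum_(t < m) q^-1 ^+ t) *: (x ^+ m.-1 * a').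
  elim: m => [|m IHm]; first by rewrite !big_ord0 !scale0r mul1r mulr1 !subrr.
  have -> : x ^+ m.+1 * y - y * x ^+ m.+1 =
      x * (x ^+ m * y - y * x ^+ m) + (x * y - y * x) * x ^+ m.
    by rewrite mulrBl mulrBr exprS -!mulrA addrA subrK.
  rewrite {}IHm xy mulrBl (qcomm_exprr _ ax) (qcomm_exprr _ a'x) !big_ord_recr /=.
  rewrite mulrBr -!scalerAr !mulrA !scalerDl -!exprS addrACA -opprD; congr (_ - _).
  - by case: m => [|m]; rewrite ?big_ord0 ?scale0r //.
  - by case: m => [|m]; rewrite ?big_ord0 ?scale0r //.
have prim_qV : n.-primitive_root q^-1 by apply: prim_root_inv.
apply/eqP; rewrite -subr_eq0 comm (prim_root_sum prim_q) // (prim_root_sum prim_qV) //.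
by rewrite !scale0r subrr.
Qed.

Section PbwRepresentation.
Variables (F : fieldType) (n : nat) (w : F).
Variables (odd_n : odd n) (prim_w : n.-primitive_root w) (n_gt2 : (2 < n)%N).
Local Notation H := (uqsl2 odd_n prim_w).
Local Notation q := (w ^+ 2).

Let n_gt0 : (0 < n)%N. Proof. exact: prim_order_gt0 prim_w. Qed.
Let n_gt1 : (1 < n)%N. Proof. exact: ltnW. Qed.
Let q_neq0 : q != 0. Proof. by rewrite expf_neq0 // (prim_root_neq0 prim_w). Qed.
Let prim_q : n.-primitive_root q. Proof. exact: prim_root_sqr. Qed.
Let qn : q ^+ n = 1. Proof. exact: prim_expr_order. Qed.

Let qXn k : (q ^+ k) ^+ n = 1. Proof. by rewrite exprAC qn expr1n. Qed.

Let T : finType := ('I_n * 'I_n * 'I_n)%type.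
Let N := #|T|.-1.
Let o := Ordinal n_gt0.
Let cardT : #|T| = N.+1.
Proof. by rewrite /N prednK //; apply/card_gt0P; exists (o, o, o). Qed.
Let idx (j i k : nat) : 'I_N.+1 :=
  cast_ord cardT (enum_rank (insubd o j, insubd o i, insubd o k)).

(* The basis vector standing for y^j z^i a^k, with k read modulo n. *)
Definition pbw_vec j i k : 'cV[F]_N.+1 :=
  if (j < n)%N && (i < n)%N then delta_mx (idx j i (k %% n)%N) 0 else 0.
Local Notation E := pbw_vec.

Let op (f : nat -> nat -> nat -> 'cV[F]_N.+1) : 'M[F]_N.+1 :=
  \matrix_(s, t) let p := enum_val (cast_ord (esym cardT) t) in
                 f p.1.1 p.1.2 p.2 s 0.

Let vec_mod j i k : E j i (k %% n)%N = E j i k.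
Proof. by rewrite /pbw_vec modn_mod. Qed.

Let vec_big j i k : (n <= j)%N || (n <= i)%N -> E j i k = 0.
Proof. by rewrite /pbw_vec !ltnNge -negb_or => ->. Qed.

(** The hypotheses say that [f] respects truncation in [j], [i] and periodicity in [k]; then the
    matrix follows [f] at all indices, not just at those of the basis. *)
Let opE (f : nat -> nat -> nat -> 'cV[F]_N.+1) :
  (forall j i k, (n <= j)%N || (n <= i)%N -> f j i k = 0) ->
  (forall j i k, f j i (k %% n)%N = f j i k) ->
  forall j i k, op f *m E j i k = f j i k.
Proof.
move=> f0 fm j i k; have [big|] := boolP ((n <= j)%N || (n <= i)%N).
  by rewrite vec_big // mulmx0 f0.
rewrite negb_or -!ltnNge => /andP[jn i_n].
rewrite /pbw_vec jn i_n /= -colE -[RHS]fm; apply/colP => s; rewrite !mxE.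
by rewrite cast_ordK enum_rankK /= !val_insubd jn i_n ltn_mod n_gt0.
Qed.

Let op_ext (A B : 'M[F]_N.+1) :
  (forall j i k, A *m E j i k = B *m E j i k) -> A = B.
Proof.
move=> AB; apply/matrixP => s t.
have [p ->] : exists p : T, t = cast_ord cardT (enum_rank p).
  by exists (enum_val (cast_ord (esym cardT) t)); rewrite enum_valK cast_ordKV.
case: p => [[j i] k]; have /colP/(_ s) := AB j i k.
rewrite /pbw_vec !ltn_ord modn_small // /idx !valKd.
by rewrite -!colE !mxE.
Qed.

Let qint j : F := \sum_(t < j) q ^+ t.
Let qint0 : qint 0 = 0. Proof. exact: big_ord0. Qed.
Let qintS j : qint j.+1 = qint j + q ^+ j. Proof. exact: big_ord_recr. Qed.
Let qintS' j : qint j.+1 = 1 + q * qint j.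
Proof.
rewrite /qint big_ord_recl mulr_sumr; congr (_ + _).
by apply: eq_bigr => t _; rewrite -exprS.
Qed.
Let qintn : qint n = 0. Proof. exact: prim_root_sum prim_q n_gt1. Qed.

(* The coefficients come from z y^j = q^j y^j z + [j] y^(j-1) (q - q^j a^-2). *)
Let A := op (fun j i k => (q ^+ i / q ^+ j) *: E j i k.+1).
Let Y := op (fun j i k => E j.+1 i k).
Let Z := op (fun j i k => q ^+ j *: E j i.+1 k
  + qint j *: (q *: E j.-1 i k - (q ^+ j / q ^+ (2 * i)) *: E j.-1 i (k + n.-2)%N)).

Let vecDn j i k l : E j i (k %% n + l)%N = E j i (k + l)%N.
Proof. by rewrite -vec_mod modnDml vec_mod. Qed.
Let vecn j i k : E j i (k + n)%N = E j i k.
Proof. by rewrite -vec_mod modnDr vec_mod. Qed.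

Let AE j i k : A *m E j i k = (q ^+ i / q ^+ j) *: E j i k.+1.
Proof.
rewrite opE // => {}j {}i {}k => [big|]; first by rewrite vec_big // scaler0.
by rewrite -(addn1 (k %% n)) vecDn addn1.
Qed.
Let YE j i k : Y *m E j i k = E j.+1 i k.
Proof.
apply: opE => {}j {}i {}k => [/orP[] big|]; last exact: vec_mod.
  by rewrite vec_big // ltnW.
by rewrite vec_big // big orbT.
Qed.
Let ZE j i k : Z *m E j i k = q ^+ j *: E j i.+1 k
  + qint j *: (q *: E j.-1 i k - (q ^+ j / q ^+ (2 * i)) *: E j.-1 i (k + n.-2)%N).
Proof.
apply: opE => {}j {}i {}k; last by rewrite !vec_mod vecDn.
case/orP=> [nj|ni]; last first.
  have E0 m l : E m i l = 0 by rewrite vec_big // ni orbT.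
  rewrite !E0 vec_big ?subr0 ?scaler0 ?subr0 ?scaler0 ?addr0 //.
  by rewrite (leqW ni) orbT.
rewrite vec_big ?nj // scaler0 add0r.
(* At [j = n] the lowered vector need not vanish; it is killed by [qint n = 0]. *)
have [->|j_neq] := eqVneq j n; first by rewrite qintn scale0r.
by rewrite !vec_big ?scaler0 ?subr0 ?scaler0 //; lia.
Qed.

Let X := Z * A.
Let mulE (B C : 'M[F]_N.+1) (v : 'cV[F]_N.+1) : (B * C) *m v = B *m (C *m v).
Proof. by rewrite -mulmxE mulmxA. Qed.
Let qV_neq0 k : q ^+ k != 0. Proof. exact: expf_neq0. Qed.

Let AmE m j i k : A ^+ m *m E j i k = (q ^+ i / q ^+ j) ^+ m *: E j i (k + m)%N.
Proof.
elim: m k => [|m IHm] k; first by rewrite mul1mx scale1r addn0.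
by rewrite exprSr mulE AE -scalemxAr IHm scalerA -exprS addSnnS.
Qed.

Let YmE m j i k : Y ^+ m *m E j i k = E (j + m)%N i k.
Proof.
elim: m j => [|m IHm] j; first by rewrite mul1mx addn0.
by rewrite exprSr mulE YE IHm addSnnS.
Qed.

Let An : A ^+ n = 1.
Proof.
by apply: op_ext => j i k; rewrite AmE vecn mul1mx expr_div_n !qXn divr1 scale1r.
Qed.

Let Yn : Y ^+ n = 0.
Proof. by apply: op_ext => j i k; rewrite YmE mul0mx vec_big // leq_addl. Qed.

Let AZ : A * Z = q *: (Z * A).
Proof.
apply: op_ext => j i k; rewrite -scalemxAl !mulE AE -scalemxAr !ZE.
rewrite mulmxDr -!scalemxAr mulmxBr -!scalemxAr !AE.
have qi0 := qV_neq0 i; case: j => [|j].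
  rewrite qint0 !scale0r !addr0; apply/colP => s; rewrite !mxE !(exprS q) /=.
  move: (q ^+ i) (q) qi0 q_neq0 => Qi r Qi0 r0.
  by field; rewrite ?oner_eq0.
have qj0 := qV_neq0 j; rewrite -addSn; apply/colP => s; rewrite !mxE !(exprS q) /=.
move: (q ^+ i) (q ^+ j) (q ^+ (2 * i)) (q) qi0 qj0 (qV_neq0 (2 * i)) q_neq0.
by move=> Qi Qj Qi2 r Qi0 Qj0 Qi20 r0; field; rewrite ?Qi0 ?Qj0 ?Qi20 ?r0.
Qed.

Let AY : A * Y = w ^- 2 *: (Y * A).
Proof.
apply: op_ext => j i k; rewrite -scalemxAl !mulE YE !AE -scalemxAr YE scalerA.
by congr (_ *: _); rewrite (exprS q) invfM mulrCA.
Qed.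

Let AX : A * X = q *: (X * A).
Proof. by rewrite /X mulrA AZ -scalerAl. Qed.

Let XY : X * Y - Y * X = A - A ^+ n.-1.
Proof.
apply: op_ext => j i k; rewrite !mulmxBl !mulE YE !AE AmE -!scalemxAr !ZE /=.
rewrite mulmxDr -!scalemxAr mulmxBr -!scalemxAr !YE.
have -> : (k.+1 + n.-2 = k + n.-1)%N by lia.
(* The factor is an [n]th root of unity, so its power [n.-1] is its inverse. *)
have -> : (q ^+ i / q ^+ j) ^+ n.-1 = q ^+ j / q ^+ i.
  have qij : q ^+ i / q ^+ j != 0 by rewrite mulf_neq0 ?invr_eq0.
  apply: (mulfI qij); rewrite -exprS prednK // expr_div_n !qXn divr1.
  by field; rewrite !qV_neq0.
(* [j.-1.+1] differs from [j] only at [j = 0], where the coefficient is zero. *)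
have pE l : qint j *: E j.-1.+1 i l = qint j *: E j i l.
  by case: j => [|j] //; rewrite qint0 !scale0r.
have -> : qint j *: (q *: E j.-1.+1 i k.+1 - (q ^+ j / q ^+ (2 * i)) *: E j.-1.+1 i (k + n.-1)%N)
    = qint j *: (q *: E j i k.+1 - (q ^+ j / q ^+ (2 * i)) *: E j i (k + n.-1)%N).
  rewrite !scalerBr !(scalerA (qint j)) !(mulrC (qint j)) -!scalerA.
  by rewrite !pE.
apply/colP => s; rewrite !mxE (exprS q) mulnC exprM.
have qj0 := qV_neq0 j; have qi0 := qV_neq0 i.
(* Telescoping the geometric sum expresses [q ^+ j] through [qint j]; what remains is a rational
   identity. *)
have qjE : q ^+ j = 1 + q * qint j - qint j by rewrite -qintS' qintS addrAC subrr add0r.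
rewrite qintS'; move: qjE qi0 qj0 q_neq0.
move: (q ^+ i) (q ^+ j) (qint j) (q) => Qi Qj J r -> Qi0 Qj0 r0.
by field; rewrite Qi0 Qj0 r0.
Qed.

Let X_pow m i k : exists c : F, X ^+ m *m E 0 i k = c *: E 0 (i + m)%N (k + m)%N.
Proof.
elim: m i k => [|m IHm] i k; first by exists 1; rewrite mul1mx scale1r !addn0.
rewrite exprSr mulE mulE AE -scalemxAr ZE qint0 scale0r addr0 scale1r -scalemxAr.
have [c ->] := IHm i.+1 k.+1.
by exists (q ^+ i / q ^+ 0 * c); rewrite scalerA !addSnnS.
Qed.

(* X ^+ n commutes with Y, so it is enough to kill the vectors E 0 i k. *)
Let Xn : X ^+ n = 0.
Proof.
have aV : A * A ^+ n.-1 = 1 by rewrite -exprS prednK.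
have Va : A ^+ n.-1 * A = 1 by rewrite -exprSr prednK.
have XnY : X ^+ n * Y = Y * X ^+ n by apply: (uq_comm_xn prim_q n_gt1 aV Va AX XY).
apply: op_ext => j i k; rewrite mul0mx -[E j i k]/(E (0 + j)%N i k) -YmE -mulE.
have -> : X ^+ n * Y ^+ j = Y ^+ j * X ^+ n by apply: commrX.
have [c E0] := X_pow n i k.
by rewrite mulE E0 vec_big ?scaler0 ?mulmx0 // leq_addl orbT.
Qed.

Let rep_letter (i : 'I_3) : 'M[F]_N.+1 := if i == 0 then A else if i == 1 then X else Y.

Let rep_rel : {in uq_relators n w (rep_letter 0) (rep_letter 1) (rep_letter 2), forall r, r = 0}.
Proof.
move=> r; rewrite !inE /= => /or4P[||| /or3P[]] /eqP ->.
- by rewrite An subrr.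
- exact: Xn.
- exact: Yn.
- by rewrite AX subrr.
- by rewrite AY subrr.
- by rewrite XY subrr.
Qed.

Let rep : H -> 'M[F]_N.+1 := uq_lift rep_rel.

Local Notation a := (uq_a odd_n prim_w).
Local Notation x := (uq_x odd_n prim_w).
Local Notation y := (uq_y odd_n prim_w).

(** Acting on the cyclic vector [E 0 0 0] separates the monomials with exponents below [n]: this is
    their linear independence. *)
Let rep_pbw j i k : rep (pbw n a x y j i k) *m E 0 0 0 = E j i k.
Proof.
have XV : X * A ^+ n.-1 = Z by rewrite -mulrA -exprS prednK // An mulr1.
have -> : rep (pbw n a x y j i k) = Y ^+ j * Z ^+ i * A ^+ k.
  rewrite /rep /pbw !rmorphM !rmorphXn rmorphM rmorphXn /= uq_lift_a uq_lift_x uq_lift_y.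
  by rewrite -XV.
have Z0 m k' l : Z ^+ m *m E 0 l k' = E 0 (l + m)%N k'.
  elim: m l => [|m IHm] l; first by rewrite mul1mx addn0.
  by rewrite exprSr mulE ZE qint0 scale0r addr0 scale1r IHm addSnnS.
by rewrite !mulE AmE divr1 !expr1n scale1r Z0 YmE.
Qed.

(** Linear independence in the form used later: the coordinates of [rep h *m E 0 0 0] serve as
    coefficient functionals. *)
Lemma pbw_linear (W : lmodType F) (g : nat -> nat -> nat -> W) :
  exists u : {linear H -> W}, forall j i k, (j < n)%N -> (i < n)%N -> (k < n)%N ->
    u (pbw n a x y j i k) = g j i k.
Proof.
pose u (h : H) : W := \sum_(p : T) (rep h *m E 0 0 0) (idx p.1.1 p.1.2 p.2) 0 *:
  g p.1.1 p.1.2 p.2.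
have u_lin : linear u.
  move=> c h h'; rewrite /u scaler_sumr -big_split /=; apply: eq_bigr => p _.
  by rewrite /rep linearP mulmxDl -scalemxAl !mxE scalerDl scalerA.
pose uL : {linear H -> W} := HB.pack u (GRing.isLinear.Build _ _ _ _ u u_lin).
exists uL => j i k jn i_n kn; rewrite /= /u rep_pbw.
rewrite (bigD1 (Ordinal jn, Ordinal i_n, Ordinal kn)) //= big1 => [|[[j' i'] k'] /=].
  by rewrite /pbw_vec jn i_n modn_small // mxE !eqxx scale1r addr0.
rewrite /pbw_vec jn i_n modn_small // mxE eqxx andbT => ne.
suff /negbTE -> : idx j' i' k' != idx j i k by rewrite scale0r.
apply: contra ne; rewrite /idx (inj_eq (@cast_ord_inj _ _ _)) (inj_eq enum_rank_inj) !valKd.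
by rewrite !xpair_eqE -!val_eqE /= !val_insubd jn i_n kn.
Qed.

End PbwRepresentation.

(** * Actions on matrix algebras *)

Section MatrixAlgebra.
Variables (F : fieldType) (m : nat).
Local Notation A := 'M[F]_m.+1.
Local Notation E i j := (delta_mx i j : A).

Lemma delta_mulE (B : A) p r i j : (E p r * B) i j = (i == p)%:R * B r j.
Proof.
rewrite -mulmxE mxE (bigD1 r) //= big1 ?addr0 => [|k /negbTE kr].
  by rewrite mxE eqxx andbT.
by rewrite mxE kr andbF mul0r.
Qed.

Lemma mul_deltaE (B : A) p r i j : (B * E p r) i j = B i p * (j == r)%:R.
Proof.
rewrite -mulmxE mxE (bigD1 p) //= big1 ?addr0 => [|k /negbTE kp].
  by rewrite mxE eqxx.
by rewrite mxE kp mulr0.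
Qed.

Lemma mx_central (Z : A) : (forall b : A, Z * b = b * Z) -> exists c, Z = c%:M.
Proof.
move=> cZ; exists (Z 0 0); apply/matrixP => i j; rewrite mxE.
have := cZ (E j 0) => /matrixP/(_ i 0); rewrite mul_deltaE delta_mulE eqxx mulr1 => ->.
by rewrite mulr_natl.
Qed.

(* Both Skolem-Noether and the innerness of skew derivations average over the
   separability idempotent sum_i E_i0 (x) E_0i. *)
Lemma sum_delta_mul (f : A -> A) (b : A) : linear f ->
  (\sum_i f (E i 0) * E 0 i) * b = \sum_i f (b * E i 0) * E 0 i.
Proof.
move=> f_lin; pose fL : {linear A -> A} := HB.pack f (GRing.isLinear.Build _ _ _ _ f f_lin).
rewrite mulr_suml.
have bE i : f (b * E i 0) = \sum_j b j i *: f (E j 0).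
  have -> : b * E i 0 = \sum_j b j i *: E j 0.
    apply/matrixP => r s; rewrite mul_deltaE summxE (bigD1 r) //= big1 ?addr0.
      by rewrite !mxE !eqxx.
    by move=> k /negbTE kr; rewrite !mxE eq_sym kr mulr0.
  rewrite -[f _]/(fL _) linear_sum; apply: eq_bigr => j _; exact: linearZ.
have Eb i : E 0 i * b = \sum_j b i j *: E 0 j.
  apply/matrixP => r s; rewrite delta_mulE summxE (bigD1 s) //= big1 ?addr0 => [|k /negbTE ks].
    by rewrite !mxE eqxx andbT mulrC.
  by rewrite !mxE [s == k]eq_sym ks andbF mulr0.
under eq_bigr do rewrite -mulrA Eb mulr_sumr.
rewrite exchange_big /=; apply: eq_bigr => i _; rewrite bE mulr_suml.
by apply: eq_bigr => j _; rewrite -scalerAr scalerAl.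
Qed.

Lemma sum_delta1 : \sum_i E i 0 * E 0 i = 1 :> A.
Proof.
rewrite -mulmxE (eq_bigr (fun i => E i i)) => [|i _]; last by rewrite mul_delta_mx.
apply/matrixP => r s; rewrite summxE mxE (bigD1 r) //= big1 ?addr0 => [|k /negbTE kr].
  by rewrite mxE eqxx eq_sym.
by rewrite mxE eq_sym kr.
Qed.

(** Averaging [f (E i 0) * E s 0] gives an intertwiner [G]. A nonzero entry of [f (E 0 0)] is an
    entry of [G], and applying [g] to matrix units turns it into an inverse. *)
Lemma skolem_noether (f g : A -> A) : linear f -> {morph f : b c / b * c} ->
  cancel f g -> cancel g f -> exists2 G : A, G \is a GRing.unit & forall b, f b * G = G * b.
Proof.
move=> f_lin fM fK gK.
have [r [s frs]] : exists r s, f (E 0 0) r s != 0.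
  have : f (E 0 0) != 0.
    have f0 : f 0 = 0 by have := f_lin (-1) 0 0; rewrite scaler0 addr0 scaleN1r addNr.
    rewrite -f0 (can_eq fK); apply/eqP => /matrixP/(_ 0 0)/eqP.
    by rewrite !mxE !eqxx oner_eq0.
  by case/matrix0Pn => r [s rs]; exists r, s.
pose G : A := \sum_i (f (E i 0) * E s 0) * E 0 i.
have fG b : f b * G = G * b.
  rewrite /G (@sum_delta_mul (fun c => f c * E s 0)); last first.
    by move=> k c d; rewrite f_lin mulrDl scalerAl.
  by rewrite mulr_sumr; apply: eq_bigr => i _; rewrite fM !mulrA.
exists G => //.
have Gr0 : G r 0 = f (E 0 0) r s.
  rewrite /G summxE (bigD1 0) //= big1 ?addr0 => [|i /negbTE i0].
    by rewrite !mul_deltaE !eqxx !mulr1.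
  by rewrite mul_deltaE [0 == i]eq_sym i0 mulr0.
(* Matrix units spread the entry [G r 0] along the diagonal. *)
have E1 : \sum_i E i r * G * E 0 i = (G r 0)%:M.
  apply/matrixP => i j; rewrite summxE (bigD1 i) //= big1 ?addr0 => [|k /negbTE ki].
    by rewrite mul_deltaE delta_mulE eqxx mul1r mxE mulr_natr eq_sym.
  by rewrite mul_deltaE delta_mulE eq_sym ki !mul0r.
(* By intertwining, [E i r * G = G * g (E i r)], so [G] factors out on the left. *)
have : G * (\sum_i g (E i r) * E 0 i) = (G r 0)%:M.
  by rewrite -E1 mulr_sumr; apply: eq_bigr => i _; rewrite mulrA -fG gK.
move=> GV; have : G *m ((G r 0)^-1 *: (\sum_i g (E i r) * E 0 i)) = 1%:M.
  by rewrite -scalemxAr mulmxE GV scale_scalar_mx mulVf // Gr0.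
by case/mulmx1_unit.
Qed.

Lemma skew_derivation_inner (d s : A -> A) : linear d ->
  (forall b c, d (b * c) = d b * c + s b * d c) ->
  exists Z : A, forall b, d b = Z * b - s b * Z.
Proof.
(* With this average as [Z], the twisted Leibniz rule at [b * E i 0] yields
   [Z * b = d b + s b * Z]. *)
move=> d_lin dM; exists (\sum_i d (E i 0) * E 0 i) => b.
rewrite sum_delta_mul // mulr_sumr -sumrB -[LHS]mulr1 -sum_delta1 mulr_sumr.
by apply: eq_bigr => i _; rewrite dM mulrDl !mulrA addrK.
Qed.

End MatrixAlgebra.

(** One step of a q-binomial expansion, with the summand [T] abstract so that it applies to terms
    that mix an action with right multiplication. *)
Lemma qbinom_pascal_sum (F : fieldType) (V : lmodType F) (q : F) (T : nat -> nat -> V) k :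
  \sum_(i < k.+1) qbinom q k i *: (T i.+1 (k - i)%N + q ^+ i *: T i (k - i).+1)
  = \sum_(i < k.+2) qbinom q k.+1 i *: T i (k.+1 - i)%N.
Proof.
under eq_bigr do rewrite scalerDr scalerA.
rewrite big_split /= [in RHS]big_ord_recl /= scale1r subn0.
rewrite [X in _ + X = _]big_ord_recl /= qbinom0 mulr1 scale1r subn0 addrCA; congr (_ + _).
under [RHS]eq_bigr do rewrite /bump /= add1n subSS scalerDl.
rewrite [RHS]big_split /=; congr (_ + _).
rewrite [RHS]big_ord_recr /= qbinom_small // mulr0 scale0r addr0.
by apply: eq_bigr => i _; rewrite /bump /= add1n mulrC subnSK.
Qed.

Lemma qbinom_prim_sum (F : fieldType) (V : lmodType F) (q : F) n (T : nat -> V) :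
  n.-primitive_root q -> \sum_(i < n.+1) qbinom q n i *: T i = T 0 + T n.
Proof.
move=> prim_q; have n_gt0 := prim_order_gt0 prim_q.
rewrite big_ord_recr /= qbinomnn scale1r (bigD1 (Ordinal n_gt0)) //= qbinom0 scale1r.
rewrite big1 ?addr0 // => i; rewrite -val_eqE /= => i0.
by rewrite qbinom_prim ?scale0r // lt0n i0 ltn_ord.
Qed.

Lemma subr_swap (V : zmodType) (p r s t : V) : p - r = s - t -> p - s = r - t.
Proof. by move/(canRL (subrK _)) ->; rewrite [LHS](ACl (1*4*(3*2))%AC) /= subrr add0r. Qed.

(** * Elements implementing the generators *)

Section Action.
Variables (F : fieldType) (n : nat) (w : F).
Variables (odd_n : odd n) (prim_w : n.-primitive_root w) (n_gt2 : (2 < n)%N).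
Variables (H : algType F) (a x y : H).
Hypothesis rel : {in uq_relators n w a x y, forall r, r = 0}.
Local Notation a' := (a ^+ n.-1).
Local Notation z := (x * a').
Local Notation q := (w ^+ 2).

Variables (m : nat).
Local Notation A := 'M[F]_m.+1.
Variable act : H -> A -> A.
Hypothesis act_lin : is_bilinear act.
Hypothesis act1 : forall b, act 1 b = b.
Hypothesis actM : forall g h b, act (g * h) b = act g (act h b).
Hypothesis act_a : forall b c, act a (b * c) = act a b * act a c.
Hypothesis act_y : forall b c, act y (b * c) = act y b * c + act a' b * act y c.
Hypothesis act_z : forall b c, act z (b * c) = act z b * c + act a' b * act z c.

Let n_gt0 : (0 < n)%N. Proof. exact: ltn_trans n_gt2. Qed.
Let prim_q : n.-primitive_root q. Proof. exact: prim_root_sqr. Qed.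
Let q_neq0 : q != 0. Proof. exact: prim_root_neq0 prim_q. Qed.
Let q_neq1 : q != 1.
Proof.
have := prim_order_dvd prim_q 1; rewrite expr1 => <-.
by rewrite dvdn1 gtn_eqF // ltnW.
Qed.

Let actZl k h b : act (k *: h) b = k *: act h b. Proof. exact: bilinearZl. Qed.
Let actBl g h b : act (g - h) b = act g b - act h b.
Proof.
rewrite -scaleN1r addrC; case: act_lin => /(_ b (-1) h g) /= -> _.
by rewrite scaleN1r addrC.
Qed.
Let actBr h b c : act h (b - c) = act h b - act h c.
Proof.
rewrite -scaleN1r addrC; case: act_lin => _ /(_ h (-1) c b) /= ->.
by rewrite scaleN1r addrC.
Qed.
Let act_linear h : linear (act h). Proof. by move=> k b c; case: act_lin => _ ->. Qed.

Let act_aK : cancel (act a) (act a').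
Proof. by move=> b; rewrite -actM (uq_rel_Va odd_n rel) act1. Qed.
Let act_aVK : cancel (act a') (act a).
Proof. by move=> b; rewrite -actM (uq_rel_aV odd_n rel) act1. Qed.

Section Implemented.
Variable G : A.
Hypothesis G_unit : G \is a GRing.unit.
Hypothesis actG : forall b, act a b * G = G * b.

Let GV b : G * act a' b = b * G.
Proof. by rewrite -actG act_aVK. Qed.
Let act_aV b : act a' b = G^-1 * b * G.
Proof. by rewrite -mulrA -GV mulKr. Qed.

(** Comparing the actions of [a * t] and [t * a] shows [G * Z0 - r *: (Z0 * G)] to be central.
    Adding a multiple of [G^-1] to [Z0] keeps the inner formula and moves this scalar. *)
Lemma normalise_inner (t : H) (r : F) (Z0 : A) : r != 1 -> a * t = r *: (t * a) ->
  (forall b, act t b = Z0 * b - act a' b * Z0) ->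
  exists2 Z : A, G * Z = r *: (Z * G) & forall b, act t b = Z * b - act a' b * Z.
Proof.
move=> r1 at_ Z0E.
have [b|c cE] := @mx_central F m (G * Z0 - r *: (Z0 * G)).
  have El : act (a * t) b * G = G * Z0 * b - b * G * Z0.
    by rewrite actM actG Z0E mulrBr !mulrA GV.
  have Er : act (t * a) b * G = Z0 * G * b - b * Z0 * G.
    by rewrite actM Z0E act_aK mulrBl -(mulrA Z0 (act a b)) actG mulrA.
  rewrite mulrBl mulrBr -scalerAl -scalerAr !mulrA; apply: subr_swap.
  by rewrite -El at_ actZl -scalerAl Er scalerBr.
(* This multiple of [G^-1] shifts the scalar by exactly [- c]. *)
exists (Z0 - (c / (1 - r)) *: G^-1) => [|b].
  have r1' : 1 - r != 0 by rewrite subr_eq0 eq_sym.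
  rewrite mulrBr mulrBl scalerBr -scalerAr -scalerAl divrr ?mulVr ?unitmxE // scalerA.
  apply: subr_swap; rewrite cE -scalerBl -{1}[c / _]mul1r -mulrBl mulrCA divff // mulr1.
  by rewrite scalemx1.
have E : (c / (1 - r)) *: G^-1 * b = act a' b * ((c / (1 - r)) *: G^-1).
  by rewrite -scalerAl -scalerAr act_aV mulrK.
by rewrite Z0E mulrBl mulrBr E opprB subrKA.
Qed.

(** Left multiplication by [Z] splits as [Z * c = act t c + act a' c * Z], two operations that
    q-commute, so powers expand as in the q-binomial theorem. *)
Lemma inner_power (t : H) (r : F) (Z b : A) k : a' * t = r *: (t * a') ->
  (forall b, act t b = Z * b - act a' b * Z) ->
  Z ^+ k * b = \sum_(i < k.+1) qbinom r k i *: (act (t ^+ i * a' ^+ (k - i)) b * Z ^+ (k - i)).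
Proof.
move=> ta ZE; elim: k => [|k IHk]; first by rewrite big_ord1 !mul1r act1 mulr1 scale1r.
rewrite exprS -mulrA IHk mulr_sumr.
pose T i j := act (t ^+ i * a' ^+ j) b * Z ^+ j.
rewrite -(@qbinom_pascal_sum F A r T); apply: eq_bigr => i _.
rewrite -scalerAr mulrA; congr (_ *: _).
have -> c : Z * c = act t c + act a' c * Z by rewrite ZE subrK.
rewrite mulrDl -!actM !mulrA -exprS (qcomm_exprr _ ta) -!scalerAl actZl -scalerAl.
by rewrite -scalerAl -(mulrA (t ^+ i)) -(mulrA _ Z) -!exprS.
Qed.

Lemma inner_power_central (t : H) (r : F) (Z : A) : n.-primitive_root r ->
  a' * t = r *: (t * a') -> t ^+ n = 0 ->
  (forall b, act t b = Z * b - act a' b * Z) -> exists c, Z ^+ n = c%:M.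
Proof.
move=> prim_r ta tn ZE; apply: mx_central => b.
rewrite (inner_power _ _ ta ZE).
rewrite (@qbinom_prim_sum F A r n
  (fun i => act (t ^+ i * a' ^+ (n - i)) b * Z ^+ (n - i))) //.
(* Only the end terms are left: [t ^+ n = 0] removes one, and [a' ^+ n = 1] turns the other into
   [b * Z ^+ n]. *)
rewrite subn0 subnn tn mul0r (bilinear0l act_lin) mul0r addr0 mul1r.
by rewrite exprAC (uq_rel_aX rel) expr1n act1.
Qed.

Lemma aG_power : exists2 c : F, c != 0 & G ^+ n = c%:M.
Proof.
have aGX k b : act (a ^+ k) b * G ^+ k = G ^+ k * b.
  elim: k b => [|k IHk] b; first by rewrite act1 mulr1 mul1r.
  by rewrite exprS actM exprS mulrA actG -mulrA IHk mulrA.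
have [b|c Gc] := @mx_central F m (G ^+ n).
  by rewrite -aGX (uq_rel_aX rel) act1.
exists c => //; apply: contraTneq (unitrX n G_unit) => c0.
by rewrite Gc c0 raddf0 unitr0.
Qed.

Lemma YZ_commutator (Y Z : A) :
  G * Y = q^-1 *: (Y * G) -> G * Z = q *: (Z * G) ->
  (forall b, act y b = Y * b - act a' b * Y) ->
  (forall b, act z b = Z * b - act a' b * Z) ->
  exists k : F, Z * Y = q *: (Y * Z) + q%:M + k *: G ^- 2.
Proof.
move=> GY GZ YE ZE; pose s b := act a' b.
have sM b c : s (b * c) = s b * s c.
  by rewrite /s !act_aV -!mulrA mulVKr.
have sB b c : s (b - c) = s b - s c by apply: actBr.
have sY : s Y = q *: Y.
  by rewrite /s act_aV -mulrA -[Y * G](scalerKV q_neq0) -GY -scalerAr mulKr.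
have sZ : s Z = q^-1 *: Z.
  rewrite /s act_aV -mulrA -[Z * G](scalerK q_neq0) -GZ -scalerAr mulKr //.
(* [s] is conjugation by [G^-1], and the relation between [z] and [y] becomes [K * b = s (s b) * K];
   hence [G ^+ 2 * K] is central. *)
pose K := Z * Y - q *: (Y * Z) - q%:M.
have zyE b : act (z * y) b = q *: act (y * z) b + q *: (b - s (s b)).
  rewrite (uq_rel_zy odd_n prim_w rel).
  case: act_lin => /(_ b q (y * z) (q *: (1 - a' * a'))) /= -> _.
  by rewrite actZl actBl act1 (actM a').
have KE b : K * b = s (s b) * K.
  have := zyE b; rewrite (actM z) (actM y) (YE b) (ZE b) YE ZE -!/(s _).
  rewrite !sB !sM sY sZ /K !(mulrBl, mulrBr).
  rewrite -!scalerAl -!scalerAr -!scalerAl -mulmxE mul_scalar_mx mul_mx_scalar mulmxE !mulrA.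
  (* The equation is linear in these products, so they become unknowns and the identity is checked
     entrywise over the field. *)
  move: (Z * Y * b) (Z * s b * Y) (Y * s b * Z) (s (s b) * Y * Z) (Y * Z * b).
  move: (s (s b) * Z * Y) => P6; move: (s (s b)) => P8 P1 P2 P3 P4 P5 E.
  apply/matrixP => i j; have := congr1 (fun M : A => M i j) E; rewrite !mxE.
  move: (q) q_neq0 => r r0 e; apply/eqP; rewrite -subr_eq0; apply/eqP.
  move/eqP: e; rewrite -subr_eq0 => /eqP <-.
  by field.
have [b|k kE] := @mx_central F m (G ^+ 2 * K).
  have GG : G ^+ 2 * s (s b) = b * G ^+ 2.
    by rewrite expr2 -(mulrA G) /s GV (mulrA G) GV mulrA.
  by rewrite -mulrA KE mulrA GG mulrA.
exists k; have G2 : G ^+ 2 \is a GRing.unit by rewrite unitrX.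
have <- : K = k *: G ^- 2.
  by rewrite -[LHS](mulKr G2) kE -mulmxE mul_mx_scalar.
by rewrite /K !addrA [RHS](ACl (3*(1*4)*(2*5))%AC) /= !subrr !addr0.
Qed.

End Implemented.

Lemma action_implemented : exists G Y Z : A,
  [/\ G \is a GRing.unit, forall b, act a b * G = G * b,
      forall b, act y b = Y * b - act a' b * Y
    & forall b, act z b = Z * b - act a' b * Z] /\
  [/\ exists2 c : F, c != 0 & G ^+ n = c%:M,
      G * Y = q^-1 *: (Y * G) /\ G * Z = q *: (Z * G),
      exists c, Y ^+ n = c%:M, exists c, Z ^+ n = c%:M
    & exists k : F, Z * Y = q *: (Y * Z) + q%:M + k *: G ^- 2].
Proof.
have [G G_unit actG] := skolem_noether (act_linear a) act_a act_aK act_aVK.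
have [Y0 Y0E] := skew_derivation_inner (act_linear y) act_y.
have [Z0 Z0E] := skew_derivation_inner (act_linear z) act_z.
have qV1 : q^-1 != 1 by rewrite invr_eq1.
have [Y GY YE] := normalise_inner G_unit actG qV1 (uq_rel_ay rel) Y0E.
have [Z GZ ZE] := normalise_inner G_unit actG q_neq1 (uq_rel_az odd_n rel) Z0E.
exists G, Y, Z; split; first by [].
have Vz : a' * z = q^-1 *: (z * a').
  have Vx : a' * x = q^-1 *: z by rewrite (uq_rel_xV odd_n rel) scalerA mulVf // scale1r.
  by rewrite mulrA Vx -scalerAl.
split; first exact: aG_power.
- by [].
- exact: (inner_power_central prim_q (uq_rel_Vy odd_n prim_w rel) (uq_rel_yX rel) YE).
- exact: (inner_power_central (prim_root_inv prim_q) Vz (uq_rel_zX odd_n rel) ZE).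
- exact: YZ_commutator G_unit actG _ _ GY GZ YE ZE.
Qed.
End Action.

(** * Convolution *)

Section Convolution.
Variables (F : fieldType) (n : nat) (w : F).
Variables (odd_n : odd n) (prim_w : n.-primitive_root w).
Variables (H : algType F) (a x y : H).
Hypothesis rel : {in uq_relators n w a x y, forall r, r = 0}.
Local Notation a' := (a ^+ n.-1).
Local Notation z := (x * a').
Local Notation pbw := (pbw n a x y).

(** The Hopf algebra is represented by its abstract features: generation, the PBW basis, and
    recursion rules for sums over the comultiplication. *)
Hypothesis H_gen : forall P : H -> Prop,
  P 1 -> (forall k h, P h -> P (k *: h)) ->
  (forall g h, P g -> P h -> P (g + h)) ->
  (forall h, P h -> P (a * h)) -> (forall h, P h -> P (x * h)) ->
  (forall h, P h -> P (y * h)) -> forall h, P h.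
Hypothesis H_linear : forall (W : lmodType F) (g : nat -> nat -> nat -> W),
  exists u : {linear H -> W}, forall j i k, (j < n)%N -> (i < n)%N -> (k < n)%N ->
    u (pbw j i k) = g j i k.

(* D h is a formal sum representing the comultiplication of h. *)
Variable D : H -> seq (H * H).
Definition csum (W : nmodType) (f : H -> H -> W) (h : H) : W :=
  \sum_(p <- D h) f p.1 p.2.

Hypothesis csum_linear : forall (W : lmodType F) (f : H -> H -> W),
  is_bilinear f -> linear (csum f).
Hypothesis csum1 : forall (W : lmodType F) (f : H -> H -> W),
  is_bilinear f -> csum f 1 = f 1 1.
Hypothesis csum_aX : forall (W : lmodType F) (f : H -> H -> W) k h,
  is_bilinear f -> csum f (a ^+ k * h) = csum (fun g g' => f (a ^+ k * g) (a ^+ k * g')) h.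
Hypothesis csum_y : forall (W : lmodType F) (f : H -> H -> W) h,
  is_bilinear f -> csum f (y * h) =
  csum (fun g g' => f (y * g) g') h + csum (fun g g' => f (a' * g) (y * g')) h.
Hypothesis csum_x : forall (W : lmodType F) (f : H -> H -> W) h,
  is_bilinear f -> csum f (x * h) =
  csum (fun g g' => f (x * g) (a * g')) h + csum (fun g g' => f g (x * g')) h.
Variable eps : {lrmorphism H -> F^o}.
Hypotheses (eps_a : eps a = 1) (eps_x : eps x = 0) (eps_y : eps y = 0).

Let H_ind := pbw_small_ind odd_n prim_w rel H_gen.

Lemma csum_ext (W : nmodType) (f g : H -> H -> W) h :
  (forall h1 h2, f h1 h2 = g h1 h2) -> csum f h = csum g h.
Proof. by move=> fg; apply: eq_bigr => p _; apply: fg. Qed.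

Lemma csumD (W : nmodType) (f g : H -> H -> W) h :
  csum (fun h1 h2 => f h1 h2 + g h1 h2) h = csum f h + csum g h.
Proof. exact: big_split. Qed.

Lemma csum_mull (B : pzRingType) (b : B) (f : H -> H -> B) h :
  csum (fun h1 h2 => b * f h1 h2) h = b * csum f h.
Proof. by rewrite /csum mulr_sumr. Qed.

Lemma csum_mulr (B : pzRingType) (b : B) (f : H -> H -> B) h :
  csum (fun h1 h2 => f h1 h2 * b) h = csum f h * b.
Proof. by rewrite /csum mulr_suml. Qed.

Lemma csumZ (W : lmodType F) k (f : H -> H -> W) h :
  csum (fun h1 h2 => k *: f h1 h2) h = k *: csum f h.
Proof. by rewrite /csum scaler_sumr. Qed.

Lemma csum0 (W : lmodType F) (f : H -> H -> W) : is_bilinear f -> csum f 0 = 0.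
Proof.
by move=> Hf; have := csum_linear Hf (-1) 0 0; rewrite scaler0 addr0 scaleN1r addNr.
Qed.

Lemma csum_a1 (W : lmodType F) (f : H -> H -> W) h :
  is_bilinear f -> csum f (a * h) = csum (fun g g' => f (a * g) (a * g')) h.
Proof. exact: (@csum_aX W f 1). Qed.

(** * Counit and coassociativity *)

Definition trilinear (W : lmodType F) (f : H -> H -> H -> W) : Prop :=
  [/\ forall h2 h3, linear (fun h1 => f h1 h2 h3),
      forall h1 h3, linear (fun h2 => f h1 h2 h3)
    & forall h1 h2, linear (fun h3 => f h1 h2 h3)].

(** Induction on generators with [f] general: a left factor moves into [f], and [eps x = eps y = 0]
    deletes the terms with that generator in the first slot. *)
Lemma csum_counitl (W : lmodType F) (f : H -> W) h : linear f ->
  csum (fun h1 h2 => (eps h1 : F) *: f h2) h = f h.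
Proof.
move=> Hf.
have bil (g : H -> W) : linear g -> is_bilinear (fun h1 h2 : H => (eps h1 : F) *: g h2).
  move=> Hg; split=> [h2|h1] k c d /=.
    by rewrite [eps _]linearP scalerDl scalerA.
  by rewrite Hg scalerDr !scalerA mulrC.
have lin (g : H -> W) (k : H) : linear g -> linear (fun h : H => g (k * h)).
  by move=> Hg r c d; rewrite mulrDr -scalerAr Hg.
have f0 (g : H -> W) : linear g -> g 0 = 0.
  by move=> Hg; have := Hg (-1) 0 0; rewrite scaler0 addr0 scaleN1r addNr.
elim/H_gen: h f Hf => [|k h IH|g h IHg IHh|h IH|h IH|h IH] f Hf.
- rewrite csum1; last exact: bil.
  by rewrite [eps _]rmorph1 scale1r.
- rewrite -[k *: h]addr0 (csum_linear (bil _ Hf)) Hf (IH _ Hf) (f0 _ Hf).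
  by rewrite csum0 //; apply: bil.
- by rewrite -[g]scale1r (csum_linear (bil _ Hf)) Hf (IHg _ Hf) (IHh _ Hf).
- rewrite csum_a1; last exact: bil.
  apply: etrans (IH _ (lin _ a Hf)); apply: csum_ext => g g'.
  by rewrite rmorphM /= eps_a mul1r.
- rewrite csum_x; last exact: bil.
  rewrite [X in X + _]big1 => [|p _]; last first.
    by rewrite rmorphM /= eps_x mul0r scale0r.
  rewrite add0r; exact: (IH _ (lin _ x Hf)).
- rewrite csum_y; last exact: bil.
  rewrite [X in X + _]big1 => [|p _]; last first.
    by rewrite rmorphM /= eps_y mul0r scale0r.
  rewrite add0r; apply: etrans (IH _ (lin _ y Hf)).
  by apply: csum_ext => g g'; rewrite rmorphM rmorphXn /= eps_a expr1n mul1r.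
Qed.

Lemma csum_counitr (W : lmodType F) (f : H -> W) h : linear f ->
  csum (fun h1 h2 => (eps h2 : F) *: f h1) h = f h.
Proof.
move=> Hf.
have bil (g : H -> W) : linear g -> is_bilinear (fun h1 h2 : H => (eps h2 : F) *: g h1).
  move=> Hg; split=> [h2|h1] k c d /=.
    by rewrite Hg scalerDr !scalerA mulrC.
  by rewrite [eps _]linearP scalerDl scalerA.
have lin (g : H -> W) (k : H) : linear g -> linear (fun h : H => g (k * h)).
  by move=> Hg r c d; rewrite mulrDr -scalerAr Hg.
have f0 (g : H -> W) : linear g -> g 0 = 0.
  by move=> Hg; have := Hg (-1) 0 0; rewrite scaler0 addr0 scaleN1r addNr.
elim/H_gen: h f Hf => [|k h IH|g h IHg IHh|h IH|h IH|h IH] f Hf.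
- rewrite csum1; last exact: bil.
  by rewrite [eps _]rmorph1 scale1r.
- rewrite -[k *: h]addr0 (csum_linear (bil _ Hf)) Hf (IH _ Hf) (f0 _ Hf).
  by rewrite csum0 //; apply: bil.
- by rewrite -[g]scale1r (csum_linear (bil _ Hf)) Hf (IHg _ Hf) (IHh _ Hf).
- rewrite csum_a1; last exact: bil.
  apply: etrans (IH _ (lin _ a Hf)); apply: csum_ext => g g'.
  by rewrite rmorphM /= eps_a mul1r.
- rewrite csum_x; last exact: bil.
  rewrite [X in _ + X]big1 => [|p _]; last first.
    by rewrite rmorphM /= eps_x mul0r scale0r.
  rewrite addr0; apply: etrans (IH _ (lin _ x Hf)).
  by apply: csum_ext => g g'; rewrite rmorphM /= eps_a mul1r.
- rewrite csum_y; last exact: bil.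
  rewrite [X in _ + X]big1 => [|p _]; last first.
    by rewrite rmorphM /= eps_y mul0r scale0r.
  rewrite addr0; exact: (IH _ (lin _ y Hf)).
Qed.

(** It suffices to compare both sides under left multiplication by a generator; the induction
    hypothesis is applied to [f] with multiplied arguments. *)
Lemma csum_coassoc (W : lmodType F) (f : H -> H -> H -> W) h : trilinear f ->
  csum (fun h1 h' => csum (f h1) h') h =
  csum (fun h' h3 => csum (fun h1 h2 => f h1 h2 h3) h') h.
Proof.
move=> Hf.
have bil1 (g : H -> H -> H -> W) k : trilinear g -> is_bilinear (g k).
  by case=> _ g2 g3; split=> [h2|h1]; [apply: g2 | apply: g3].
have bil3 (g : H -> H -> H -> W) k :
    trilinear g -> is_bilinear (fun h1 h2 => g h1 h2 k).
  by case=> g1 g2 _; split=> [h2|h1]; [apply: g1 | apply: g2].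
have bilr (g : H -> H -> H -> W) :
    trilinear g -> is_bilinear (fun h1 h' => csum (g h1) h').
  move=> Hg; split=> [h2|h1] k c d /=; last exact/csum_linear/bil1.
  case: Hg => g1 _ _; rewrite -csumZ -csumD.
  by apply: csum_ext => h1 h3; apply: g1.
have bill (g : H -> H -> H -> W) :
    trilinear g -> is_bilinear (fun h' h3 => csum (fun h1 h2 => g h1 h2 h3) h').
  move=> Hg; split=> [h2|h1] k c d /=; first exact: (csum_linear (bil3 _ _ Hg)).
  case: Hg => _ _ g3; rewrite -csumZ -csumD.
  by apply: csum_ext => h2 h3; apply: g3.
have tri (g : H -> H -> H -> W) k1 k2 k3 : trilinear g ->
    trilinear (fun h1 h2 h3 => g (k1 * h1) (k2 * h2) (k3 * h3)).
  case=> g1 g2 g3; split=> c d k u v; rewrite mulrDr -scalerAr;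
  by [apply: g1 | apply: g2 | apply: g3].
have tri1 (g : H -> H -> H -> W) k1 : trilinear g ->
    trilinear (fun h1 h2 h3 => g (k1 * h1) h2 h3).
  case=> g1 g2 g3; split=> c d k u v; rewrite ?mulrDr -?scalerAr;
  by [apply: g1 | apply: g2 | apply: g3].
have tri2 (g : H -> H -> H -> W) k1 k2 : trilinear g ->
    trilinear (fun h1 h2 h3 => g (k1 * h1) (k2 * h2) h3).
  case=> g1 g2 g3; split=> c d k u v; rewrite ?mulrDr -?scalerAr;
  by [apply: g1 | apply: g2 | apply: g3].
have tri3 (g : H -> H -> H -> W) k3 : trilinear g ->
    trilinear (fun h1 h2 h3 => g h1 h2 (k3 * h3)).
  case=> g1 g2 g3; split=> c d k u v; rewrite ?mulrDr -?scalerAr;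
  by [apply: g1 | apply: g2 | apply: g3].
have tri23 (g : H -> H -> H -> W) k2 k3 : trilinear g ->
    trilinear (fun h1 h2 h3 => g h1 (k2 * h2) (k3 * h3)).
  case=> g1 g2 g3; split=> c d k u v; rewrite ?mulrDr -?scalerAr;
  by [apply: g1 | apply: g2 | apply: g3].
elim/H_gen: h f Hf => [|k h IH|g h IHg IHh|h IH|h IH|h IH] f Hf.
- by rewrite csum1 ?csum1; auto.
- rewrite -[k *: h]addr0 (csum_linear (bilr _ Hf)) (csum_linear (bill _ Hf)).
  rewrite (IH _ Hf); congr (_ + _).
  by rewrite !csum0; auto.
- rewrite -[g]scale1r (csum_linear (bilr _ Hf)) (csum_linear (bill _ Hf)).
  by rewrite (IHg _ Hf) (IHh _ Hf).
- rewrite csum_a1; last exact: bilr.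
  rewrite csum_a1; last exact: bill.
  transitivity (csum (fun h1 h' => csum (fun g g' => f (a * h1) (a * g) (a * g')) h') h).
    by apply: csum_ext => h1 h2; rewrite csum_a1; auto.
  apply: etrans (IH _ (tri _ a a a Hf)) _; apply: csum_ext => h1 h2.
  by rewrite (@csum_a1 _ (fun g g' => f g g' _)); auto.
- rewrite csum_x; last exact: bilr.
  rewrite csum_x; last exact: bill.
  (* Either iterated comultiplication of [x] has the three terms [x, a, a]; [1, x, a]; [1, 1, x]. *)
  have E1 : csum (fun g g' => csum (f (x * g)) (a * g')) h =
      csum (fun h' h3 => csum (fun h1 h2 => f (x * h1) (a * h2) (a * h3)) h') h.
    apply: etrans (IH _ (tri _ x a a Hf)); apply: csum_ext => h1 h2.
    by rewrite csum_a1; auto.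
  have E2 : csum (fun g g' => csum (f g) (x * g')) h =
      csum (fun h' h3 => csum (fun h1 h2 => f h1 (x * h2) (a * h3)) h') h
      + csum (fun h' h3 => csum (fun h1 h2 => f h1 h2 (x * h3)) h') h.
    apply: etrans (congr2 +%R (IH _ (tri23 _ x a Hf)) (IH _ (tri3 _ x Hf))).
    by rewrite -csumD; apply: csum_ext => h1 h2; rewrite csum_x; auto.
  apply: etrans (congr2 +%R E1 E2) _; rewrite addrA; congr (_ + _).
  rewrite -csumD; apply: csum_ext => h1 h2.
  by rewrite (@csum_x _ (fun g g' => f g g' _)); auto.
- rewrite csum_y; last exact: bilr.
  rewrite csum_y; last exact: bill.
  (* For [y] the three terms are [y, 1, 1]; [a', y, 1]; [a', a', y]. *)
  have E1 : csum (fun g g' => csum (f (y * g)) g') h =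
      csum (fun h' h3 => csum (fun h1 h2 => f (y * h1) h2 h3) h') h.
    exact: (IH _ (tri1 _ y Hf)).
  have E2 : csum (fun g g' => csum (f (a' * g)) (y * g')) h =
      csum (fun h' h3 => csum (fun h1 h2 => f (a' * h1) (y * h2) h3) h') h
      + csum (fun h' h3 => csum (fun h1 h2 => f (a' * h1) (a' * h2) (y * h3)) h') h.
    apply: etrans (congr2 +%R (IH _ (tri2 _ a' y Hf)) (IH _ (tri _ a' a' y Hf))).
    by rewrite -csumD; apply: csum_ext => h1 h2; rewrite csum_y; auto.
  apply: etrans (congr2 +%R E1 E2) _; rewrite addrA; congr (_ + _).
    rewrite -csumD; apply: csum_ext => h1 h2.
    by rewrite (@csum_y _ (fun g g' => f g g' _)); auto.
  apply: csum_ext => h1 h2.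
  by rewrite (@csum_aX _ (fun g g' => f g g' _)); auto.
Qed.

(** * The comultiplication on PBW monomials *)

Lemma csum_a (W : lmodType F) (f : H -> H -> W) k :
  is_bilinear f -> csum f (a ^+ k) = f (a ^+ k) (a ^+ k).
Proof.
move=> Hf; rewrite -[in LHS](mulr1 (a ^+ k)) csum_aX // csum1; last exact: bilinear_mull.
by rewrite mulr1.
Qed.

Lemma bilinear_mulll (W : lmodType F) (f : H -> H -> W) g :
  is_bilinear f -> is_bilinear (fun h h' => f (g * h) h').
Proof. by move=> [f1 f2]; split=> [h'|h] k c d /=; rewrite ?mulrDr -?scalerAr ?f1 ?f2. Qed.

Lemma bilinear_mulrl (W : lmodType F) (f : H -> H -> W) g :
  is_bilinear f -> is_bilinear (fun h h' => f h (g * h')).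
Proof. by move=> [f1 f2]; split=> [h'|h] k c d /=; rewrite ?mulrDr -?scalerAr ?f1 ?f2. Qed.

(* Unlike x, the element z is (1, a^-1)-skew-primitive, exactly as y is. *)
Lemma csum_z (W : lmodType F) (f : H -> H -> W) h : is_bilinear f ->
  csum f (z * h) = csum (fun g g' => f (z * g) g') h + csum (fun g g' => f (a' * g) (z * g')) h.
Proof.
move=> Hf; rewrite -mulrA csum_x // csum_aX; last exact: bilinear_mull.
rewrite csum_aX; last exact: bilinear_mulrl.
by congr (_ + _); apply: csum_ext => g g'; rewrite !mulrA ?(uq_rel_aV odd_n rel) ?mul1r.
Qed.

(** The second tensor factors of [pbw j i k] are combinations of [pbw l m k] with [l <= j] and
    [m <= i]: the left coideal property, stated without naming the subspace. *)
Lemma csum_pbw_ext (W : lmodType F) (f f' : H -> H -> W) j i k :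
  is_bilinear f -> is_bilinear f' ->
  (forall g l m, (l <= j)%N -> (m <= i)%N -> f g (pbw l m k) = f' g (pbw l m k)) ->
  csum f (pbw j i k) = csum f' (pbw j i k).
Proof.
elim: j f f' => [|j IHj] f f' Hf Hf' ff'; last first.
  rewrite -pbw_y !csum_y //; congr (_ + _).
    apply: IHj => [||g l m lj mi]; rewrite ?ff' ?leqW //; exact: bilinear_mulll.
  apply: IHj => [||g l m lj mi]; rewrite ?pbw_y ?ff' //; exact: bilinear_mull.
elim: i f f' Hf Hf' ff' => [|i IHi] f f' Hf Hf' ff'.
  have -> : pbw 0 0 k = a ^+ k by rewrite /pbw !mul1r.
  by have := ff' (a ^+ k) 0 0 isT isT; rewrite /pbw !mul1r !csum_a.
rewrite -pbw_z !csum_z //; congr (_ + _).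
  apply: IHi => [||g l m lj mi]; rewrite ?ff' ?leqW //; exact: bilinear_mulll.
apply: IHi => [||g l m]; try exact: bilinear_mull.
by rewrite leqn0 => /eqP -> mi; rewrite pbw_z ff'.
Qed.

Lemma csum_pbw0 (W : lmodType F) (f : H -> H -> W) j i k : is_bilinear f ->
  (forall g l m, (l <= j)%N -> (m <= i)%N -> f g (pbw l m k) = 0) ->
  csum f (pbw j i k) = 0.
Proof.
move=> Hf f0; rewrite (@csum_pbw_ext _ f (fun _ _ => 0)) //; first exact: big1.
by split=> [h'|h] c d e /=; rewrite scaler0 addr0.
Qed.

(* The terms of the comultiplication of lower degree in the second factor are
   killed, which leaves the one with a group-like first factor. *)
Lemma csum_pbw_lead (W : lmodType F) (f : H -> H -> W) j i k : is_bilinear f ->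
  (forall g l m, (l <= j)%N -> (m <= i)%N -> (l + m < j + i)%N -> f g (pbw l m k) = 0) ->
  csum f (pbw j i k) = f (a ^+ (n.-1 * (j + i) + k)) (pbw j i k).
Proof.
elim: j f => [|j IHj] f Hf f0; last first.
  rewrite -pbw_y csum_y // csum_pbw0 ?add0r; first last.
  - by move=> g l m lj mi; apply: f0; lia.
  - exact: bilinear_mulll.
  rewrite IHj; first last.
  - by move=> g l m lj mi lm; rewrite pbw_y f0 //; lia.
  - exact: bilinear_mull.
  (* Every [y] contributes one [a' = a ^+ n.-1] to the group-like factor. *)
  by rewrite -exprD addSn mulnS addnA.
elim: i f Hf f0 => [|i IHi] f Hf f0.
  have -> : pbw 0 0 k = a ^+ k by rewrite /pbw !mul1r.
  by rewrite csum_a // addn0 muln0.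
rewrite -pbw_z csum_z // csum_pbw0 ?add0r; first last.
- by move=> g l m lj mi; apply: f0; lia.
- exact: bilinear_mulll.
rewrite IHi; first last.
- by move=> g l m; rewrite leqn0 => /eqP -> mi lm; rewrite pbw_z f0.
- exact: bilinear_mull.
by rewrite -exprD !add0n mulnS addnA.
Qed.

(** * Convolution inverses *)

Section Algebra.
Variable A : unitAlgType F.

Definition conv (u v : H -> A) : H -> A := csum (fun h1 h2 => u h1 * v h2).

Lemma bilinear_conv (u v : {linear H -> A}) : is_bilinear (fun h1 h2 => u h1 * v h2).
Proof.
by split=> [h'|h] k c d /=; rewrite linearP ?mulrDl ?mulrDr -?scalerAl -?scalerAr.
Qed.

Lemma conv_linear (u v : {linear H -> A}) : linear (conv u v).
Proof. exact/csum_linear/bilinear_conv. Qed.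

Lemma conv_assoc (u v t : {linear H -> A}) h : conv u (conv v t) h = conv (conv u v) t h.
Proof.
rewrite /conv.
transitivity (csum (fun h1 h' => csum (fun h2 h3 => u h1 * (v h2 * t h3)) h') h).
  by apply: csum_ext => h1 h2; rewrite csum_mull.
rewrite (@csum_coassoc A (fun h1 h2 h3 => u h1 * (v h2 * t h3))).
  apply: csum_ext => h' h3; rewrite -csum_mulr.
  by apply: csum_ext => h1 h2; rewrite mulrA.
split=> g g' k c d; rewrite linearP.
- by rewrite mulrDl -scalerAl.
- by rewrite mulrDl mulrDr -scalerAl -scalerAr.
- by rewrite !mulrDr -!scalerAr.
Qed.

(** Solve for [v] by increasing degree [j + i]: the leading coefficient, a value of [u] on a power
    of [a], is invertible. *)
Lemma conv_right_inverse (u : {linear H -> A}) :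
  (forall k, u (a ^+ k) \is a GRing.unit) ->
  exists v : {linear H -> A}, forall h, conv u v h = (eps h : F) *: 1.
Proof.
move=> u_unit.
(* All degrees are below [n + n], so finitely many corrections suffice. *)
have [v Hv] : exists v : {linear H -> A}, forall j i k,
    (j < n)%N -> (i < n)%N -> (k < n)%N -> (j + i < n + n)%N ->
    conv u v (pbw j i k) = (eps (pbw j i k) : F) *: 1.
  elim: (n + n)%N => [|d [v Hv]].
    by have [v _] := H_linear (fun _ _ _ => 0 : A); exists v.
  (* The correction lives in degree [d] alone and is the remaining defect divided by the leading
     coefficient. *)
  have [t Ht] := H_linear (fun j i k => if (j + i == d)%N
    then (u (a ^+ (n.-1 * (j + i) + k)))^-1 *
         ((eps (pbw j i k) : F) *: 1 - conv u v (pbw j i k)) else 0).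
  exists (v \+ t) => j i k jn i_n kn ji.
  have -> : conv u (v \+ t) (pbw j i k) = conv u v (pbw j i k) + conv u t (pbw j i k).
    by rewrite -csumD; apply: csum_ext => h1 h2; rewrite mulrDr.
  move: ji; rewrite ltnS leq_eqVlt => /orP[/eqP jid|ji]; last first.
    rewrite Hv // [conv u t _]csum_pbw0 ?addr0 //; first exact: bilinear_conv.
    by move=> g l m lj mi; rewrite Ht ?ifF ?mulr0 //; lia.
  rewrite [conv u t _]csum_pbw_lead; first last.
  - by move=> g l m lj mi lm; rewrite Ht ?ifF ?mulr0 //; lia.
  - exact: bilinear_conv.
  by rewrite Ht // jid eqxx mulVKr // addrC subrK.
exists v; apply: H_ind => [k g h Pg Ph|j i k jn i_n kn]; last by apply: Hv => //; lia.
by rewrite conv_linear Pg Ph linearP scalerDl scalerA.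
Qed.

(** A right inverse [v] is invertible on powers of [a], so it has a right inverse [t] in turn;
    associativity gives [u = t], and [v] is two-sided. *)
Lemma conv_inverse (u : {linear H -> A}) :
  (forall k, u (a ^+ k) \is a GRing.unit) ->
  exists v : {linear H -> A}, forall h,
    conv u v h = (eps h : F) *: 1 /\ conv v u h = (eps h : F) *: 1.
Proof.
move=> u_unit; have [v uv] := conv_right_inverse u_unit; exists v => h; split=> //.
have v_unit k : v (a ^+ k) \is a GRing.unit.
  have := uv (a ^+ k); rewrite /conv csum_a; last exact: bilinear_conv.
  rewrite rmorphXn /= eps_a expr1n scale1r => uv1.
  by rewrite -[v _](mulKr (u_unit k)) uv1 mulr1 unitrV.
have [t vt] := conv_right_inverse v_unit.
suff ut g : u g = t g by rewrite -vt; apply: csum_ext => h1 h2; rewrite ut.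
have -> : u g = conv u (conv v t) g.
  rewrite -[LHS](@csum_counitr A u) //; last exact: linearP.
  by apply: csum_ext => h1 h2; rewrite vt -scalerAr mulr1.
rewrite conv_assoc -[RHS](@csum_counitl A t) //; last exact: linearP.
by apply: csum_ext => h1 h2; rewrite uv -scalerAl mul1r.
Qed.

Variable act : H -> A -> A.
Hypothesis act_lin : is_bilinear act.
Hypothesis act1 : forall b, act 1 b = b.
Hypothesis actM : forall g h b, act (g * h) b = act g (act h b).

(** * The intertwining identity and the inner formula *)

Section Intertwiner.
Variables (G Y Z : A) (u : {linear H -> A}).
Hypothesis u_pbw : forall j i k, (j < n)%N -> (i < n)%N -> (k < n)%N ->
  u (pbw j i k) = Y ^+ j * Z ^+ i * G ^+ k.
Hypothesis actG : forall b, act a b * G = G * b.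
Hypothesis actY : forall b, act y b = Y * b - act a' b * Y.
Hypothesis actZ : forall b, act z b = Z * b - act a' b * Z.

Let actGX k b : act (a ^+ k) b * G ^+ k = G ^+ k * b.
Proof.
elim: k b => [|k IHk] b; first by rewrite act1 mulr1 mul1r.
by rewrite exprS actM exprS mulrA actG -mulrA IHk mulrA.
Qed.

Let bil (b : A) (v : {linear H -> A}) : is_bilinear (fun h1 h2 => act h1 b * v h2).
Proof.
split=> [h'|h] k c d /=; last by rewrite linearP mulrDr -scalerAr.
by case: act_lin => -> _; rewrite mulrDl -scalerAl.
Qed.

(* The intertwining property passes from e to t * e when t is skew-primitive. *)
Let intertwine_step (t : H) (C : A) e b :
  (forall c, act t c = C * c - act a' c * C) -> u (t * e) = C * u e ->
  csum (fun g g' => act (a' * g) b * u (t * g')) e =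
    csum (fun g g' => act (a' * g) b * (C * u g')) e ->
  csum (fun h1 h2 => act h1 b * u h2) e = u e * b ->
  csum (fun g g' => act (t * g) b * u g') e +
    csum (fun g g' => act (a' * g) b * u (t * g')) e = u (t * e) * b.
Proof.
move=> actt ute E IH; rewrite E -csumD ute -mulrA -IH -csum_mull.
by apply: csum_ext => h1 h2; rewrite !actM actt mulrBl -mulrA [X in _ + X]mulrA subrK.
Qed.

(** [u] need not be multiplicative, yet it respects prefixing [y], or [z] when no [y] is present,
    while exponents stay below [n]; [csum_pbw_ext] confines the second factors to that range. *)
Lemma csum_intertwine h b : csum (fun h1 h2 => act h1 b * u h2) h = u h * b.
Proof.
move: h; apply: H_ind => [k g h Pg Ph|j i k jn i_n kn].
  by rewrite (csum_linear (bil b u)) Pg Ph linearP mulrDl scalerAl.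
have n_gt0 : (0 < n)%N by apply: leq_ltn_trans jn.
have u_z l : (l.+1 < n)%N -> u (pbw 0 l.+1 k) = Z * u (pbw 0 l k).
  by move=> ln; rewrite !u_pbw ?(ltnW ln) // exprS !mul1r !mulrA.
have u_y m l : (m.+1 < n)%N -> (l < n)%N -> u (pbw m.+1 l k) = Y * u (pbw m l k).
  by move=> mn ln; rewrite !u_pbw ?(ltnW mn) // exprS !mulrA.
have bil1 t : is_bilinear (fun g g' => act (a' * g) b * u (t * g')).
  exact: (bilinear_mull a' t (bil b u)).
have bil2 C : is_bilinear (fun g g' => act (a' * g) b * (C * u g')).
  split=> [h'|h] k' c d /=; rewrite ?mulrDr -?scalerAr.
    by case: act_lin => -> _; rewrite mulrDl -scalerAl.
  by rewrite linearP !mulrDr -!scalerAr.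
elim: j jn => [|j IHj] jn; last first.
  rewrite -pbw_y csum_y //; apply: (intertwine_step actY); last exact/IHj/ltnW.
    by rewrite pbw_y u_y.
  apply: csum_pbw_ext => // g l m lj mi; rewrite pbw_y u_y //; first exact: leq_ltn_trans jn.
  exact: leq_ltn_trans i_n.
elim: i i_n => [|i IHi] i_n; last first.
  rewrite -pbw_z csum_z //; apply: (intertwine_step actZ); last exact/IHi/ltnW.
    by rewrite pbw_z u_z.
  apply: csum_pbw_ext => // g l m; rewrite leqn0 => /eqP -> mi; rewrite pbw_z u_z //.
  exact: leq_ltn_trans i_n.
have uk : u (a ^+ k) = G ^+ k by have := u_pbw jn i_n kn; rewrite /pbw !mul1r.
have -> : pbw 0 0 k = a ^+ k by rewrite /pbw !mul1r.
by rewrite csum_a // uk actGX.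
Qed.

(** Convolving the intertwining identity on the right with [v] cancels [u] beside the action. *)
Lemma csum_inner (v : {linear H -> A}) h b :
  (forall h, conv u v h = (eps h : F) *: 1) ->
  act h b = csum (fun h1 h2 => u h1 * b * v h2) h.
Proof.
move=> uv.
transitivity (csum (fun h' h3 => csum (fun h1 h2 => act h1 b * u h2) h' * v h3) h); last first.
  by apply: csum_ext => h1 h2; rewrite csum_intertwine.
transitivity (csum (fun h' h3 => csum (fun h1 h2 => act h1 b * u h2 * v h3) h') h); last first.
  by apply: csum_ext => h1 h2; rewrite csum_mulr.
rewrite -(@csum_coassoc A (fun h1 h2 h3 => act h1 b * u h2 * v h3)); last first.
  split=> g g' k c d.
  - by case: act_lin => -> _; rewrite !mulrDl -!scalerAl.
  - by rewrite linearP mulrDr mulrDl -scalerAr -scalerAl.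
  - by rewrite linearP mulrDr -scalerAr.
rewrite -[LHS](@csum_counitr A (act^~ b)); last by case: act_lin => + _; apply.
apply: csum_ext => h1 h2; rewrite -[X in _ *: X]mulr1 scalerAr -uv /conv -csum_mull.
by apply: csum_ext => g g'; rewrite mulrA.
Qed.

End Intertwiner.
End Algebra.

(** * Assembling the inner action *)

Section MatrixAction.
Hypothesis n_gt2 : (2 < n)%N.
Variable m : nat.
Local Notation A := 'M[F]_m.+1.
Variable act : H -> A -> A.
Hypothesis act_lin : is_bilinear act.
Hypothesis act1 : forall b, act 1 b = b.
Hypothesis actM : forall g h b, act (g * h) b = act g (act h b).
Hypothesis act_csum :
  forall h b c, act h (b * c) = csum (fun h1 h2 => act h1 b * act h2 c) h.

Let act_bil b c : is_bilinear (fun h1 h2 => act h1 b * act h2 c).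
Proof.
split=> [h'|h] k g g' /=; case: act_lin => -> _.
  by rewrite mulrDl -scalerAl.
by rewrite mulrDr -scalerAr.
Qed.

Theorem matrix_action_inner : exists u : {linear H -> A},
  [/\ u 1 = 1 /\ (exists2 v : {linear H -> A},
        forall h, conv u v h = (eps h : F) *: 1 /\ conv v u h = (eps h : F) *: 1
        & forall h b, act h b = csum (fun h1 h2 => u h1 * b * v h2) h),
      forall b, [/\ act a b = u a * b * (u a)^-1,
                   act x b = u x * b * (u a)^-1 - b * u x * (u a)^-1
                 & act y b = u y * b - (u a)^-1 * b * u a * u y]
    & exists theta tau mu nu : F, theta != 0 /\
        [/\ u a ^+ n = theta%:M,
            u a * u x = w ^+ 2 *: (u x * u a) /\ u a * u y = w ^- 2 *: (u y * u a),
            u x ^+ n = mu%:M, u y ^+ n = nu%:M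
          & u x * u y - u y * u x = u a - tau *: (u a)^-1]].
Proof.
have act_a b c : act a (b * c) = act a b * act a c.
  by rewrite act_csum -[a]expr1 csum_a.
have act_y b c : act y (b * c) = act y b * c + act a' b * act y c.
  rewrite act_csum -[y in LHS]mulr1 csum_y // !csum1.
  - by rewrite !mulr1 act1.
  - exact: (bilinear_mull a' y (act_bil b c)).
  - exact: (bilinear_mulll y (act_bil b c)).
have act_z b c : act z (b * c) = act z b * c + act a' b * act z c.
  rewrite act_csum -[z in LHS]mulr1 csum_z // !csum1.
  - by rewrite !mulr1 act1.
  - exact: (bilinear_mull a' z (act_bil b c)).
  - exact: (bilinear_mulll z (act_bil b c)).
have [G [Y [Z [[G_unit actG actY actZ] [[theta theta0 Gn] [GY GZ] [nu Yn] [zeta Zn] [k ZY]]]]]]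
  := action_implemented odd_n prim_w n_gt2 rel act_lin act1 actM act_a act_y act_z.
have [u u_pbw] := H_linear (fun j i k => Y ^+ j * Z ^+ i * G ^+ k).
have n_gt0 : (0 < n)%N by apply: ltn_trans n_gt2.
have n_gt1 : (1 < n)%N by apply: ltnW.
have ua : u a = G.
  by have := u_pbw 0 0 1 n_gt0 n_gt0 n_gt1; rewrite /pbw !mul1r.
have uy : u y = Y.
  by have := u_pbw 1 0 0 n_gt1 n_gt0 n_gt0; rewrite /pbw !mulr1.
have ux : u x = Z * G.
  by have := u_pbw 0 1 1 n_gt0 n_gt1 n_gt1; rewrite /pbw !mul1r !expr1 (uq_rel_za odd_n rel).
(* [u] is prescribed only for exponents below [n], whence the reduction; it gives invertibility on
   all powers of [a]. *)
have u_aX l : u (a ^+ l) = G ^+ (l %% n).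
  have := u_pbw 0 0 (l %% n)%N n_gt0 n_gt0; rewrite ltn_mod n_gt0 => /(_ isT).
  by rewrite /pbw !mul1r (expr_mod _ (uq_rel_aX rel)).
have act_aV b : act a' b = G^-1 * b * G.
  rewrite -{2}[b]act1 -(uq_rel_aV odd_n rel) actM -mulrA.
  by rewrite actG mulKr.
have [|v uv] := @conv_inverse A u; first by move=> l; rewrite u_aX unitrX.
exists u; rewrite ua ux uy; split.
- split; first by rewrite -(expr0 a) u_aX mod0n.
  exists v => // h b; apply: (csum_inner act_lin act1 actM u_pbw actG actY actZ) => g.
  by case: (uv g).
- move=> b; split.
  + by rewrite -actG mulrK.
  (* [act x] is [act z] after [act a], and the twist by [a'] cancels the one by [a]. *)
  + rewrite -(uq_rel_za odd_n rel) actM actZ -actM (uq_rel_Va odd_n rel) act1.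
    by rewrite -(mulrA Z G) -actG !mulrA !mulrK.
  + by rewrite actY act_aV.
(* [tau] comes from the coefficient [k] of [G ^- 2]; [mu] includes the cost of separating
   [(Z * G) ^+ n] into powers. *)
exists theta, (- (w ^- 2 * k)), ((w ^+ 2) ^+ 'C(n, 2) * zeta * theta), nu; split=> //.
have q_neq0 : w ^+ 2 != 0 by rewrite expf_neq0 // (prim_root_neq0 prim_w).
split=> //.
- by split=> //; rewrite mulrA GZ -scalerAl.
- by rewrite (qcomm_exprM _ GZ) Zn Gn -mulmxE -scalar_mxM scale_scalar_mx mulrA.
(* With [G] on the right the formula for [Z * Y] applies: its constant [w ^+ 2] becomes the term
   [G], and its last term a multiple of [G^-1]. *)
have ZGY : Z * G * Y = w ^- 2 *: (Z * Y * G).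
  by rewrite -mulrA GY -scalerAr mulrA.
rewrite ZGY ZY !mulrDl -!scalerAl !scalerDr !scalerA mulVf // scale1r mulrA.
rewrite -mulmxE mul_scalar_mx scalerA mulVf // scale1r mulmxE.
have -> : G ^- 2 * G = G^-1 by rewrite expr2 invrM // -mulrA mulVr ?mulr1.
by rewrite scaleNr opprK [LHS](ACl ((1*4)*2*3)%AC) /= subrr add0r.
Qed.

End MatrixAction.
End Convolution.

Theorem proposition8p1 (n : nat) (n_ge3 : (3 <= n)%N) (odd_n : odd n)
    (F : fieldType) (w : F) (prim_w : n.-primitive_root w)
    (m : nat) (act : uqsl2 odd_n prim_w -> 'M[F]_m.+1 -> 'M[F]_m.+1) :
  module_algebra act ->
  exists u : {linear uqsl2 odd_n prim_w -> 'M[F]_m.+1},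
    let ua := u (uq_a odd_n prim_w) in
    let ux := u (uq_x odd_n prim_w) in
    let uy := u (uq_y odd_n prim_w) in
    [/\ inner_via act u,
        forall b,
          [/\ act (uq_a odd_n prim_w) b = ua * b * ua^-1,
              act (uq_x odd_n prim_w) b = ux * b * ua^-1 - b * ux * ua^-1
            & act (uq_y odd_n prim_w) b = uy * b - ua^-1 * b * ua * uy]
      & exists theta tau mu nu : F,
          theta != 0 /\
          [/\ ua ^+ n = theta%:M,
              ua * ux = w ^+ 2 *: (ux * ua)
                /\ ua * uy = w ^- 2 *: (uy * ua),
              ux ^+ n = mu%:M,
              uy ^+ n = nu%:M
            & ux * uy - uy * ux = ua - tau *: ua^-1]].
Proof.
move=> [act_lin [act1 actM _ act_comul]].
have rel := @uq_relE F n w odd_n prim_w.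
(* This choice makes [csum] unfold to [sweedler]. *)
pose D (h : uqsl2 odd_n prim_w) := repr (uq_comul h).
exact: (@matrix_action_inner F n w odd_n prim_w _ _ _ _ rel
  (@uq_ind F n w odd_n prim_w) (pbw_linear odd_n prim_w n_ge3) D
  (@sweedler_linear _ _ _ _ _) (@sweedler1 _ _ _ _ _)
  (fun W f k h Hf => sweedler_aX Hf k h)
  (fun W f h Hf => sweedler_y Hf h)
  (fun W f h Hf => sweedler_x Hf h)
  (@uq_counit F n w odd_n prim_w)
  (uq_counit_a _ _) (uq_counit_x _ _) (uq_counit_y _ _)
  n_ge3 m act act_lin act1 actM act_comul).
Qed.
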